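(* Let $d\ge 3$ be a fixed integer, $\varepsilon\in(0,1/2]$ fixed, and $b=1/(8\ln d)$. Let $\delta<\min(1/16,\,b\varepsilon)$. Then any deterministic (adaptive) algorithm for the NoisyParities$(d,\varepsilon)$ problem on $n$-vertex instances which makes at most $n^{1/2+\delta}$ queries outputs the correct answer (YES or NO) with probability at most $1/2+o(1)$ as $n\to\infty$.
   Context: NoisyParities$(d,\varepsilon)$: An adversary samples a random $d$-regular multigraph $G=(V,E)$ on $n$ vertices from the configuration model (each vertex gets $d$ half-edges and half-edges are paired uniformly at random; self-loops and parallel edges allowed). With probability $1/2$ each, the adversary is in the YES case or NO case, and generates edge labels $Y\in\{0,1\}^E$: in the YES case, the labels $Y(e)$ are independent uniform bits; in the NO case, $X\in\{0,1\}^V$ is uniform, independently $Z\in\{0,1\}^E$ has independent Bernoulli$(\varepsilon)$ entries, and $Y(e)=X(u)+X(v)+Z(e)\pmod 2$ for $e=(u,v)$. The algorithm adaptively queries vertices $q\in V$; each query returns all edges incident on $q$ together with their labels. The algorithm must decide whether it is in the YES or the NO case; probability is over the random instance. *)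

(* Defs.v *)
From mathcomp Require Import all_boot.
From Stdlib Require Import Reals.

Set Implicit Arguments.
Unset Strict Implicit.
Unset Printing Implicit Defensive.

(* Half-edges of the configuration model: (vertex, slot). *)
Definition half (n d : nat) : finType := ('I_n * 'I_d)%type.

Definition pairing (n d : nat) := {ffun half n d -> half n d}.

Definition is_matching n d (p : pairing n d) : bool :=
  [forall h, (p (p h) == h) && (p h != h)].

(* Edge labels, stored on half-edges; consistent = both halves agree. *)
Definition labels (n d : nat) := {ffun half n d -> bool}.

Definition consistent n d (p : pairing n d) (y : labels n d) : bool :=
  [forall h, y (p h) == y h].

(* Each edge {h, p h} is represented once, by the half-edge of smaller rank. *)
Definition edge_rep n d (p : pairing n d) (h : half n d) : bool :=
  (enum_rank h < enum_rank (p h))%N.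

Local Open Scope R_scope.

Definition config_prob n d (p : pairing n d) : R :=
  if is_matching p then / INR #|[pred q : pairing n d | is_matching q]| else 0.

Definition yes_prob n d (p : pairing n d) (y : labels n d) : R :=
  if consistent p y then / INR #|[pred z : labels n d | consistent p z]| else 0.

(* NO case: X uniform on {0,1}^V, Z iid Bernoulli(eps) on edges,
   Y(e) = X(u) + X(v) + Z(e) mod 2. *)
Definition no_prob n d (eps : R) (p : pairing n d) (y : labels n d) : R :=
  if consistent p y then
    \big[Rplus/0]_(X : {ffun 'I_n -> bool})
      (/ (2 ^ n) *
       \big[Rmult/1]_(h : half n d | edge_rep p h)
          (if y h == addb (X h.1) (X (p h).1) then 1 - eps else eps))
  else 0.

Definition answer_t (n d : nat) := {ffun 'I_d -> ('I_n * bool)%type}.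

Definition answer n d (p : pairing n d) (y : labels n d) (q : 'I_n)
  : answer_t n d :=
  [ffun i => ((p (q, i)).1, y (q, i))].

Definition history (n d : nat) := seq ('I_n * answer_t n d)%type.

(* Deterministic adaptive algorithm: next query and final output are
   arbitrary functions of the history so far; output true = "YES". *)
Record algorithm (n d : nat) := Algorithm {
  alg_query : history n d -> 'I_n;
  alg_out : history n d -> bool }.

Fixpoint run n d (A : algorithm n d) (p : pairing n d) (y : labels n d)
  (k : nat) : history n d :=
  match k with
  | O => [::]
  | S k' => let hs := run A p y k' in
            let q := alg_query A hs in
            rcons hs (q, answer p y q)
  end.

Definition output n d (A : algorithm n d) k p y : bool :=
  alg_out A (run A p y k).

Definition success_prob n d (eps : R) (A : algorithm n d) (k : nat) : R :=
  \big[Rplus/0]_(p : pairing n d)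
    (config_prob p *
     \big[Rplus/0]_(y : labels n d)
       (/2 * yes_prob p y * (if output A k p y then 1 else 0)
        + /2 * no_prob eps p y * (if output A k p y then 0 else 1))).

(* Main.v *)
(* Reveal half-edges one at a time. For a revealed labelled set of edges s, the
   NO/YES likelihood ratio is the Ising partition function
     G(s) = 2^-n sum_t prod_(e = (u,v) in s) (1 + th (-1)^(label e) t_u t_v),
   with th = 1 - 2 eps, and revealing one more edge {u, v} moves it by
   +- th E_t[prod * t_u t_v]. The revealed edges split into a forest (edges that
   discovered a new vertex) and collision edges (both ends already seen); let W
   be the set of ends of the latter. Conditionally on the spins on u :: W the
   collision edges are irrelevant, and belief propagation on the forest bounds
   the bias of t_v by sum_(w in u :: W) th^dist(w, v), which is at most
   d^r d^-dist + th^r in each term. Since v is the end of a uniformly random free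
   half-edge and the number of free half-edges at distance l from w is O(d^l)
   (through the potential sum_v d^-dist(w, v) (1 + free slots of v)), the
   expected increment of |G - 1| is O((|W| + 1) (d^r + th^r J) / n) after at most
   J reveals, while |W| has expectation O(J^2 / n). Summing over J = k d reveals
   with k = n^(1/2 + delta) and d^r = n^(1/4) gives
   O(n^(3 delta - 1/4) + n^(4 delta - eps / (2 ln d))). *)
Require Import Defs.
From Stdlib Require Import ZArith Reals Lra Lia.
Set Implicit Arguments. Unset Strict Implicit. Unset Printing Implicit Defensive.

(** * Asymptotics of the bound *)

Section RealEstimates.
Local Open Scope R_scope.

(** The excess over 1/2 in [success_bound], up to its factor 1/2: [a] is the degree, [k * a] the
    number J of reveals, and [p], [q] stand for d^r and th^r. *)
Definition advantage (a N k p q : R) : R :=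
  k * a * (k * a * (4 * a * (k * a) / (N * a - 2 * (k * a))) + 1) *
  ((p * (2 * a) + q * (2 * a * (k * a))) / (N * a - 2 * (k * a))).

(** As 4 x <= N, the denominator is at least N a / 2; as N <= x^2, the summand 1 is absorbed into
    a^2 x^2 / N. *)
Lemma advantage_le a N k x p q :
  3 <= a -> 0 <= k <= x -> 1 <= x -> 4 * x <= N -> N <= x * x -> 0 <= p -> 0 <= q ->
  advantage a N k p q
  <= 36 * (a * a * a) * (x * x * x / (N * N) * p + a * (x * x * x * x / (N * N)) * q).
Proof.
intros a3 [k0 kx] x1 xN Nx p0 q0; unfold advantage.
set (D := N * a - 2 * (k * a)).
assert (DN : N * a / 2 <= D) by (unfold D; nra).
assert (Na0 : 0 < N * a / 2) by nra.
assert (iD : 0 <= / D <= 2 / (N * a)).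
{ split; [left; apply Rinv_0_lt_compat; lra|].
  replace (2 / (N * a)) with (/ (N * a / 2)) by (field; lra).
  apply Rinv_le_contravar; lra. }
assert (iN : 0 < / N) by (apply Rinv_0_lt_compat; lra).
assert (ka : 0 <= k * a <= x * a) by nra.
assert (c0 : 0 <= 4 * a * (k * a) / D <= 8 * a * x / N).
{ split; [apply Rmult_le_pos; nra|].
  replace (8 * a * x / N) with (4 * a * (x * a) * (2 / (N * a))) by (field; lra).
  apply Rmult_le_compat; nra. }
assert (b0 : 0 <= k * a * (4 * a * (k * a) / D) + 1 <= 9 * (a * a) * (x * x) / N).
{ split; [nra|].
  assert (h : k * a * (4 * a * (k * a) / D) <= x * a * (8 * a * x / N)).
  { apply Rmult_le_compat; lra. }
  assert (h1 : 1 <= a * a * (x * x / N)).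
  { assert (1 <= x * x / N).
    { apply Rmult_le_reg_r with N; [lra|]. unfold Rdiv; rewrite Rmult_assoc, Rinv_l; lra. }
    nra. }
  replace (9 * (a * a) * (x * x) / N) with (x * a * (8 * a * x / N) + a * a * (x * x / N)) by (field; lra).
  lra. }
assert (n0 : 0 <= (p * (2 * a) + q * (2 * a * (k * a))) / D <= 4 * (p + q * (a * x)) / N).
{ assert (t0 : 0 <= q * (k * a) <= q * (x * a)) by nra.
  assert (t1 : 0 <= p * (2 * a) + q * (2 * a * (k * a)) <= 2 * a * (p + q * (x * a))) by nra.
  split; [apply Rmult_le_pos; lra|].
  replace (4 * (p + q * (a * x)) / N) with (2 * a * (p + q * (x * a)) * (2 / (N * a))) by (field; lra).
  apply Rmult_le_compat; lra. }
apply Rle_trans with (x * a * (9 * (a * a) * (x * x) / N) * (4 * (p + q * (a * x)) / N)).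
- apply Rmult_le_compat; try lra.
  + apply Rmult_le_pos; lra.
  + apply Rmult_le_compat; lra.
- right; field; lra.
Qed.

Lemma exists_floor y : 0 <= y -> exists r : nat, INR r <= y < INR r + 1.
Proof.
intros y0; destruct (archimed y) as [u1 u2].
assert (up0 : (0 < up y)%Z) by (apply lt_IZR; lra).
exists (Z.to_nat (up y - 1)).
rewrite INR_IZR_INZ, Z2Nat.id by lia; rewrite minus_IZR; lra.
Qed.

(* The radius r is chosen about (log_a N) / 4: then a^r <= N^(1/4), while
   (1 - 2 eps)^r is at most about N^(- eps / (2 ln a)). *)
Lemma advantage_vanishes a eps delta eta :
  3 <= a -> 0 < eps <= / 2 -> 0 <= delta < / 16 -> delta < / (8 * ln a) * eps ->
  0 < eta ->
  exists M, 1 <= M /\ forall N, M <= N -> exists r : nat,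
    4 * Rpower N (/ 2 + delta) <= N /\
    forall k, 0 <= k <= Rpower N (/ 2 + delta) ->
      advantage a N k (a ^ r) ((1 - 2 * eps) ^ r) <= eta.
Proof.
intros a3 [e0 e1] [d0 d1] d2 eta0.
assert (la : 0 < ln a) by (rewrite <- ln_1; apply ln_increasing; lra).
(* With N^(1/4) for a^r and N^(- eps / (2 ln a)) for the other power, the two terms of
   [advantage_le] decay, up to constants, with exponents 1/4 - 3 delta and eps / (2 ln a) - 4 delta;
   [g] is the smaller one. *)
pose (g := Rmin (/ 4 - 3 * delta) (eps / (2 * ln a) - 4 * delta)).
assert (g0 : 0 < g).
{ apply Rmin_pos; [lra|].
  replace (eps / (2 * ln a)) with (4 * (/ (8 * ln a) * eps)) by (field; lra); lra. }
assert (g1 : g <= / 4 - 3 * delta) by apply Rmin_l.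
assert (g2 : g <= eps / (2 * ln a) - 4 * delta) by apply Rmin_r.
clearbody g.
(* The factor exp (2 eps) pays for rounding the radius down to an integer. *)
pose (C := 36 * (a * a * a) * (1 + a * exp (2 * eps))).
assert (C0 : 0 < C).
{ unfold C; pose proof (exp_pos (2 * eps)).
  apply Rmult_lt_0_compat; [|nra]. assert (0 < a * a) by nra; nra. }
(* The cap 1/4 yields 4 x <= N, the cap eta / C the final bound. *)
pose (nu := Rmin (/ 4) (eta / C)).
assert (nu0 : 0 < nu) by (apply Rmin_pos; [lra | apply Rdiv_lt_0_compat; lra]).
assert (nu1 : nu <= / 4) by apply Rmin_l.
assert (nu2 : C * nu <= eta).
{ replace eta with (C * (eta / C)) by (field; lra).
  apply Rmult_le_compat_l; [lra | apply Rmin_r]. }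
clearbody nu.
exists (Rmax 1 (exp (- ln nu / g))); split; [apply Rmax_l|].
intros N NM.
assert (N1 : 1 <= N) by (eapply Rle_trans; [apply Rmax_l | exact NM]).
pose (L := ln N).
assert (NL : N = exp L) by (unfold L; rewrite exp_ln; lra).
assert (L0 : 0 <= L).
{ unfold L; rewrite <- ln_1; destruct N1 as [N1|<-]; [left; apply ln_increasing; lra | lra]. }
assert (small : exp (- g * L) <= nu).
{ rewrite <- (exp_ln nu) by lra.
  assert (- ln nu / g <= L).
  { unfold L; rewrite <- (ln_exp (- ln nu / g)).
    assert (h : exp (- ln nu / g) <= N) by (eapply Rle_trans; [apply Rmax_r | exact NM]).
    destruct h as [h | ->]; [left; apply ln_increasing; [apply exp_pos | exact h] | lra]. }
  assert (h : - ln nu <= g * L).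
  { replace (- ln nu) with (g * (- ln nu / g)) by (field; lra).
    apply Rmult_le_compat_l; lra. }
  assert (h2 : - g * L <= ln nu) by lra.
  destruct h2 as [h2 | ->]; [left; apply exp_increasing; exact h2 | lra]. }
assert (exp_mono : forall u v, u <= v -> exp u <= exp v).
{ intros u v [h | ->]; [left; apply exp_increasing; exact h | lra]. }
destruct (exists_floor (y := L / (4 * ln a))) as [r [r1 r2]].
{ apply Rmult_le_pos; [lra | left; apply Rinv_0_lt_compat; lra]. }
exists r.
set (x := Rpower N (/ 2 + delta)).
assert (xE : x = exp ((/ 2 + delta) * L)) by reflexivity.
assert (xN : 4 * x <= N).
{ assert (h : x <= N * exp (- g * L)).
  { rewrite xE, NL, <- exp_plus; apply exp_mono; nra. }
  nra. }
split; [exact xN|].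
intros k kx.
assert (x1 : 1 <= x) by (rewrite xE, <- exp_0; apply exp_mono; nra).
assert (xx : N <= x * x) by (rewrite xE, NL, <- exp_plus; apply exp_mono; nra).
assert (rln : INR r * ln a <= L / 4).
{ replace (L / 4) with (L / (4 * ln a) * ln a) by (field; lra).
  apply Rmult_le_compat_r; lra. }
assert (ar : 0 <= a ^ r <= exp (L / 4)).
{ split; [apply pow_le; lra|].
  rewrite <- Rpower_pow by lra; apply exp_mono; exact rln. }
assert (er : 0 <= (1 - 2 * eps) ^ r <= exp (2 * eps - eps / (2 * ln a) * L)).
{ split; [apply pow_le; lra|].
  apply Rle_trans with (exp (- (2 * eps)) ^ r).
  { apply pow_incr; split; [lra|]. pose proof (exp_ineq1_le (- (2 * eps))); lra. }
  rewrite <- Rpower_pow by apply exp_pos; unfold Rpower; rewrite ln_exp.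
  apply exp_mono.
  replace (eps / (2 * ln a) * L) with (2 * eps * (L / (4 * ln a))) by (field; lra).
  nra. }
eapply Rle_trans; [apply (@advantage_le a N k x); lra|].
assert (iN : / (N * N) = exp (- (2 * L))) by (rewrite NL, <- exp_plus, <- exp_Ropp; f_equal; lra).
assert (t1 : x * x * x / (N * N) * a ^ r <= exp (- g * L)).
{ apply Rle_trans with (x * x * x / (N * N) * exp (L / 4)).
  - apply Rmult_le_compat_l; [|lra].
    unfold Rdiv; rewrite iN; pose proof (exp_pos (- (2 * L))).
    apply Rmult_le_pos; [|lra]. assert (0 <= x * x) by nra; nra.
  - unfold Rdiv; rewrite iN, xE, <- !exp_plus; apply exp_mono; nra. }
assert (t2 : x * x * x * x / (N * N) * (1 - 2 * eps) ^ r <= exp (2 * eps) * exp (- g * L)).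
{ apply Rle_trans with (x * x * x * x / (N * N) * exp (2 * eps - eps / (2 * ln a) * L)).
  - apply Rmult_le_compat_l; [|lra].
    unfold Rdiv; rewrite iN; pose proof (exp_pos (- (2 * L))).
    apply Rmult_le_pos; [|lra]. assert (0 <= x * x) by nra; nra.
  - unfold Rdiv at 1; rewrite iN, xE, <- !exp_plus; apply exp_mono; nra. }
apply Rle_trans with (C * exp (- g * L));
  [|apply Rle_trans with (C * nu); [apply Rmult_le_compat_l; lra | exact nu2]].
unfold C; rewrite !Rmult_assoc.
assert (a * (x * x * x * x / (N * N) * (1 - 2 * eps) ^ r) <= a * (exp (2 * eps) * exp (- g * L))).
{ apply Rmult_le_compat_l; lra. }
apply Rmult_le_compat_l; [lra|].
do 3 (apply Rmult_le_compat_l; [lra|]).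
lra.
Qed.

End RealEstimates.

From mathcomp Require Import all_boot all_order all_algebra perm.
From mathcomp Require Import ring lra.
From mathcomp Require Import Rstruct.
(* Again after all_boot, whose half is integer halving. *)
Import Defs.
Import Order.TTheory GRing.Theory Num.Theory.
Local Open Scope ring_scope.

(** * Labels and matchings compatible with the revealed edges *)

Section Matching.
Variables n d : nat.
Implicit Types (p : pairing n d) (y : labels n d) (h : half n d).

Lemma matchingK p : is_matching p -> involutive p.
Proof. by move=> /forallP pM h; have /andP[/eqP] := pM h. Qed.

Lemma matching_neq p h : is_matching p -> p h != h.
Proof. by move=> /forallP /(_ h) /andP[]. Qed.

Lemma consistentE p y h : consistent p y -> y (p h) = y h.
Proof. by move=> /forallP /(_ h) /eqP. Qed.

Lemma edge_rep_other p h : is_matching p -> edge_rep p (p h) = ~~ edge_rep p h.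
Proof.
move=> pM; rewrite /edge_rep matchingK // -leqNgt ltn_neqAle.
case: eqP => // /ord_inj /enum_rank_inj ph.
by have := matching_neq h pM; rewrite ph eqxx.
Qed.

(** A revealed edge: the queried half-edge, then its partner, then the label. *)
Definition entry := (half n d * half n d * bool)%type.
Implicit Types (e : entry) (s : seq entry).

Definition touched s : seq (half n d) := flatten [seq [:: e.1.1; e.1.2] | e <- s].

Definition agrees_pairing p s := all (fun e => p e.1.1 == e.1.2) s.
Definition agrees_labels y s := all (fun e => y e.1.1 == e.2) s.

Lemma size_touched s : size (touched s) = (2 * size s)%N.
Proof. by elim: s => //= e s IH; rewrite IH mulnS. Qed.

Lemma touchedP s h :
  h \in touched s -> exists2 e, e \in s & h = e.1.1 \/ h = e.1.2.
Proof.
elim: s => //= e s IH; rewrite !inE => /or3P[/eqP->|/eqP->|/IH[e' e's hE]].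
- by exists e; [rewrite inE eqxx | left].
- by exists e; [rewrite inE eqxx | right].
- by exists e' => //; rewrite inE e's orbT.
Qed.

Lemma mem_touched s e : e \in s -> (e.1.1 \in touched s) * (e.1.2 \in touched s).
Proof.
elim: s => //= e' s IH; rewrite !inE => /predU1P[->|/IH[-> ->]].
  by rewrite !eqxx ?orbT.
by rewrite !orbT.
Qed.

(** * Sums over consistent labellings *)

Section LabelSums.
Variables (R : comNzRingType) (p : pairing n d).
Hypothesis pM : is_matching p.

(** A consistent labelling is a free choice of values on the edge representatives. Distributivity
    ranges over functions that are [false] elsewhere; [ofrep] copies the values to the other
    halves. *)
Lemma sum_consistent (g : half n d -> bool -> R) :
  \sum_(y : labels n d | consistent p y) \prod_(h | edge_rep p h) g h (y h)
  = \prod_(h | edge_rep p h) \sum_b g h b.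
Proof.
rewrite (@big_distr_big _ _ _ _ _ _ _ false) /=.
pose ofrep (f : labels n d) : labels n d :=
  [ffun h => if edge_rep p h then f h else f (p h)].
pose torep (y : labels n d) : labels n d :=
  [ffun h => if edge_rep p h then y h else false].
rewrite (reindex_onto ofrep torep) /=; last first.
  move=> y yC; apply/ffunP => h; rewrite !ffunE edge_rep_other //.
  by case: (boolP (edge_rep p h)) => //= _; rewrite (consistentE _ yC).
apply: eq_big => [f|f _]; last first.
  by apply: eq_bigr => h hr; rewrite ffunE hr.
apply/andP/pfamilyP => [[_ /eqP fE]|[supp _]]; last split.
- split=> // ; apply/supportP => h hr.
  rewrite -fE ffunE; case: ifP => // hr'; case/negP: hr; exact: hr'.
- apply/forallP => h; rewrite !ffunE matchingK // edge_rep_other //.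
  by case: (edge_rep p h).
- apply/eqP/ffunP => h; rewrite !ffunE.
  by case: (boolP (edge_rep p h)) => // hr; rewrite (supportP supp).
Qed.

(** Labels of distinct edges are independent: toggling the label on both halves of the first edge of
    [s] changes only the factor of that edge, which can thus be split off. *)
Lemma label_mass (g : half n d -> bool -> R) s :
    agrees_pairing p s -> uniq (touched s) ->
    (forall h b, g (p h) b = g h b) -> (forall h, \sum_b g h b = 1) ->
  \sum_(y : labels n d | consistent p y && agrees_labels y s)
      \prod_(h | edge_rep p h) g h (y h)
  = \prod_(e <- s) g e.1.1 e.2.
Proof.
move=> + + gp g1; elim: s => [|[[h h'] b] s IH] /=.
  move=> _ _; rewrite big_nil (eq_bigl (consistent p)) => [|y]; last exact: andbT.
  by rewrite sum_consistent; apply: big1.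
move=> /andP[/eqP phE] ps /and3P[].
rewrite inE negb_or => /andP[hh' hs] h's us.
rewrite big_cons /= -IH //; set W := fun y : labels n d => \prod_(k | edge_rep p k) g k (y k).
pose S c := \sum_(y : labels n d | consistent p y && agrees_labels y s && (y h == c)) W y.
have SE : \sum_(y : labels n d | consistent p y && agrees_labels y s) W y = S b + S (~~ b).
  rewrite (bigID (fun y : labels n d => y h == b)) /=; congr (_ + _).
  by apply: eq_bigl => y; case: (y h); case: (b).
have -> : \sum_(y : labels n d | consistent p y && ((y h == b) && agrees_labels y s))
   \prod_(k | edge_rep p k) g k (y k) = S b.
  by apply: eq_bigl => y; rewrite -andbA; congr andb; rewrite andbC.
pose flip (y : labels n d) : labels n d := [ffun k => y k (+) (k \in [:: h; h'])].
have flipK : involutive flip.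
  by move=> y; apply/ffunP => k; rewrite !ffunE -addbA addbb addbF.
have mem_p k : (p k \in [:: h; h']) = (k \in [:: h; h']).
  rewrite !inE -phE (inv_eq (matchingK pM)) (can_eq (matchingK pM)).
  by rewrite orbC.
(* Cross-multiplied, because [g h b] may vanish and [R] is only a ring. *)
have flipS : S (~~ b) * g h b = S b * g h (~~ b).
  rewrite /S (reindex_inj (inv_inj flipK)) /= !mulr_suml.
  have flipC y : consistent p (flip y) = consistent p y.
    by apply: eq_forallb => k; rewrite !ffunE mem_p (inj_eq (@addIb _)).
  apply: eq_big => [y|y].
    rewrite flipC ffunE inE eqxx /= -andbA -[RHS]andbA; congr andb.
    congr andb; last by case: (y h); case: (b).
    apply: eq_in_all => e es; rewrite ffunE.
    suff -> : (e.1.1 \in [:: h; h']) = false by rewrite addbF.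
    apply/negbTE; rewrite !inE negb_or.
    have [e1 _] := mem_touched es.
    by apply/andP; split; [apply: contraNneq hs|apply: contraNneq h's] => <-.
  rewrite flipC => /andP[/andP[yC _] /eqP]; rewrite ffunE inE eqxx addbT => yh.
  have {yh}yh : y h = b by case: (y h) yh; case: (b).
  (* The representative of {h, h'} carries the only factor that the flip changes. *)
  pose r := if edge_rep p h then h else h'.
  have rr : edge_rep p r.
    by rewrite /r; case: ifP => // nh; rewrite -phE edge_rep_other // nh.
  have yr : y r = b.
    by rewrite /r; case: ifP => _ //; rewrite -phE (consistentE _ yC).
  have gr c : g r c = g h c by rewrite /r; case: ifP => _ //; rewrite -phE gp.
  have rin : r \in [:: h; h'] by rewrite /r; case: ifP; rewrite !inE eqxx ?orbT.
  rewrite /W [X in X * _ = _](bigD1 r) //= [X in _ = X * _](bigD1 r) //=.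
  rewrite !gr ffunE yr rin addbT.
  rewrite (eq_bigr (fun k => g k (y k))); first by ring.
  move=> k /andP[kr knr]; rewrite ffunE.
  suff -> : (k \in [:: h; h']) = false by rewrite addbF.
  apply: contraTF kr => kin.
  move: kin knr rr; rewrite /r !inE -phE => /orP[]/eqP ->; rewrite ?edge_rep_other //;
    by case: ifP; rewrite ?eqxx // ?edge_rep_other.
rewrite SE mulrDr [_ * S (~~ b)]mulrC flipS [in LHS](_ : S b = S b * \sum_c g h c).
  by rewrite big_bool /=; case: (b); rewrite /=; ring.
by rewrite g1 mulr1.
Qed.

End LabelSums.

(** * Counting the matchings that extend the revealed edges *)

Section MatchingCount.

Definition num_ext s := #|[pred p | is_matching p && agrees_pairing p s]|.

(* Conjugating by a transposition of two untouched half-edges permutes the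
   matchings extending s, so every possible partner is equally likely. *)
Lemma num_ext_swap s h h1 h2 b1 b2 :
    h \notin touched s -> h1 \notin touched s -> h2 \notin touched s ->
    h1 != h -> h2 != h ->
  (num_ext ((h, h1, b1) :: s) <= num_ext ((h, h2, b2) :: s))%N.
Proof.
move=> hs h1s h2s h1h h2h.
pose t := tperm h1 h2.
pose f p : pairing n d := [ffun x => t (p (t x))].
have tK : involutive t by exact: tpermK.
have f_inj : injective f.
  move=> p q /ffunP pq; apply/ffunP => x; have := pq (t x).
  by rewrite !ffunE tK => /perm_inj.
rewrite /num_ext -(card_imset _ f_inj); apply/subset_leq_card/subsetP => q /imsetP[p].
rewrite !inE /= => /and3P[pM /eqP ph ps] ->; apply/and3P; split.
- apply/forallP => x; rewrite !ffunE tK matchingK // tK eqxx /=.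
  by rewrite -(inj_eq (@perm_inj _ t)) tK matching_neq.
- by rewrite ffunE [t h]tpermD // ph /t tpermL.
- apply/allP => e es; have /allP/(_ e es)/eqP pe := ps.
  have [e1 e2] := mem_touched es.
  rewrite ffunE [t e.1.1]tpermD ?pe ?[t _]tpermD //.
  all: by apply: contraTneq isT => E; move: e1 e2; rewrite -?E ?(negPf h1s) ?(negPf h2s).
Qed.

Lemma agrees_pairing_untouched p s h : is_matching p -> agrees_pairing p s ->
  h \notin touched s -> p h \notin touched s.
Proof.
move=> pM ps; apply: contra => /touchedP[e es phE].
have [e1 e2] := mem_touched es; have /allP/(_ e es)/eqP pe := ps.
case: phE => /(congr1 p); rewrite matchingK // => ->; first by rewrite pe.
by rewrite -pe matchingK.
Qed.

Lemma card_untouched s : uniq (touched s) ->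
  #|[pred h | h \notin touched s]| = (n * d - 2 * size s)%N.
Proof.
move=> us; have := cardC (mem (touched s)).
rewrite (card_uniqP us) size_touched card_prod !card_ord => <-.
by rewrite addKn; apply: eq_card => h; rewrite !inE.
Qed.

(** The partner of [h] is one of the untouched half-edges other than [h], whence the predecessor,
    and [num_ext_swap] makes all of them equally frequent. *)
Lemma num_ext_cons s h h' b :
    uniq (touched s) -> h \notin touched s -> h' \notin touched s -> h' != h ->
  num_ext s = ((n * d - 2 * size s).-1 * num_ext ((h, h', b) :: s))%N.
Proof.
move=> us hs h's h'h.
rewrite {1}/num_ext -sum1_card.
rewrite (partition_big (fun p : pairing n d => p h)
   [pred x | (x \notin touched s) && (x != h)]) /=; last first.
  move=> p; rewrite inE => /andP[pM ps].
  by rewrite agrees_pairing_untouched // matching_neq.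
rewrite (eq_bigr (fun _ => num_ext ((h, h', b) :: s))) /=.
  rewrite sum_nat_const; congr muln.
  rewrite -(card_untouched us) [in RHS](cardD1 h) inE hs /=.
  by apply: eq_card => x; rewrite !inE andbC.
move=> x /andP[xs xh]; rewrite sum1_card.
transitivity (num_ext ((h, x, b) :: s)).
  apply: eq_card => p; rewrite [in LHS]unfold_in !inE /= -andbA; congr andb.
  by rewrite andbC.
by apply/eqP; rewrite eqn_leq !num_ext_swap.
Qed.

End MatchingCount.
End Matching.

(** * Bias in a spin system on a forest *)

Section Ising.
Variables (V : finType) (R : realFieldType).
Implicit Types (s t : {ffun V -> bool}) (v w : V) (K : V -> V -> R).
Implicit Types (Psi phi : {ffun V -> bool} -> R).

Definition spin (b : bool) : R := (-1) ^+ b.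

Lemma spin_sqr b : spin b * spin b = 1.
Proof. by case: b; rewrite /spin ?expr0 ?expr1 ?mul1r // mulrNN mulr1. Qed.

Lemma spinN b : spin (~~ b) = - spin b.
Proof. by case: b; rewrite /spin ?expr0 ?expr1 ?opprK. Qed.

Lemma norm_spin b : `|spin b| = 1.
Proof. by case: b; rewrite /spin ?expr0 ?expr1 ?normrN normr1. Qed.

Definition flip_at v s : {ffun V -> bool} := [ffun w => s w (+) (w == v)].

Lemma flip_atK v : involutive (flip_at v).
Proof. by move=> s; apply/ffunP => w; rewrite !ffunE -addbA addbb addbF. Qed.

Lemma sum_spin0 (f : {ffun V -> bool} -> R) v :
  (forall s, f (flip_at v s) = f s) -> \sum_s f s * spin (s v) = 0.
Proof.
move=> fE; suff : \sum_s f s * spin (s v) = - \sum_s f s * spin (s v) by lra.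
rewrite {1}(reindex_inj (inv_inj (flip_atK v))) -sumrN; apply: eq_bigr => s _.
by rewrite fE ffunE eqxx addbT spinN mulrN.
Qed.

(** An external field in tanh form: exp (c x) is proportional to 1 + tanh(c) x for a spin x. The
    values 1 and -1 of [a w] pin the spin at [w]. *)
Definition field (a : V -> R) s := \prod_w (1 + a w * spin (s w)).

Lemma field_ge0 a s : (forall w, `|a w| <= 1) -> 0 <= field a s.
Proof.
move=> a1; apply: prodr_ge0 => w _.
have := a1 w; rewrite ler_norml => /andP[? ?].
by case: (s w); rewrite /spin ?expr0 ?expr1; lra.
Qed.

(* Under the positive weight Psi tilted by an arbitrary external field a, the
   mean of the spin at v is at most \sum_w |a w| K w v. *)
Definition bias_bound K Psi := forall a v, (forall w, `|a w| <= 1) ->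
  `|\sum_s Psi s * field a s * spin (s v)|
    <= (\sum_w `|a w| * K w v) * \sum_s Psi s * field a s.

Lemma fieldD1 a v s :
  field a s = (1 + a v * spin (s v)) * \prod_(w | w != v) (1 + a w * spin (s w)).
Proof. by rewrite /field (bigD1 v). Qed.

Lemma field_away a v s :
  field (fun w => if w == v then 0 else a w) s
  = \prod_(w | w != v) (1 + a w * spin (s w)).
Proof.
rewrite (fieldD1 _ v) eqxx mul0r addr0 mul1r; apply: eq_bigr => w wv.
by rewrite (negPf wv).
Qed.

Lemma field_flip a v s :
  field (fun w => if w == v then 0 else a w) (flip_at v s)
  = field (fun w => if w == v then 0 else a w) s.
Proof.
rewrite !field_away; apply: eq_bigr => w wv.
by rewrite ffunE (negPf wv) addbF.
Qed.

(** Without couplings the spins are independent and the mean at [v] is exactly [a v]. *)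
Lemma bias_bound_free : bias_bound (fun w v => (w == v)%:R) (fun _ => 1).
Proof.
move=> a v a1; pose a0 w := if w == v then 0 else a w.
have fE s : field a s = (1 + a v * spin (s v)) * field a0 s.
  by rewrite field_away -fieldD1.
have spin0 := sum_spin0 (field_flip a v).
have -> : \sum_s 1 * field a s * spin (s v) = a v * \sum_s field a0 s.
  rewrite mulr_sumr -[RHS]addr0 -[X in _ = _ + X]spin0 -big_split /=.
  apply: eq_bigr => s _; rewrite fE -/a0; have := spin_sqr (s v).
  move: (spin (s v)) (field a0 s) => x f xx.
  by transitivity (x * f + a v * (x * x) * f); [ring | rewrite xx; ring].
have -> : \sum_s 1 * field a s = \sum_s field a0 s.
  transitivity (\sum_s field a0 s + a v * \sum_s field a0 s * spin (s v)).
    by rewrite mulr_sumr -big_split; apply: eq_bigr => s _ /=; rewrite fE; ring.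
  by rewrite spin0 mulr0 addr0.
have a01 w : `|a0 w| <= 1 by rewrite /a0; case: eqP; rewrite ?normr0 ?ler01.
have Z0 : 0 <= \sum_s field a0 s by apply: sumr_ge0 => s _; exact: field_ge0.
rewrite normrM (ger0_norm Z0) ler_wpM2r //.
rewrite (bigD1 v) //= eqxx mulr1 lerDl; apply: sumr_ge0 => w _.
by rewrite mulr_ge0 ?ler0n.
Qed.

(** Two fields on one spin combine by the addition formula of tanh; this is its subadditivity in
    absolute value. *)
Lemma bias_combine (a e : R) : `|a| <= 1 -> `|e| < 1 ->
  [/\ 0 < 1 + a * e, `|(a + e) / (1 + a * e)| <= 1
    & `|(a + e) / (1 + a * e)| <= `|a| + `|e|].
Proof.
move=> a1 e1.
have /andP[pos _] : -1 < a * e < 1.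
  by rewrite -ltr_norml normrM; apply: le_lt_trans e1; rewrite ler_piMl.
move: (a1) (e1); rewrite ler_norml ltr_norml => /andP[al ar] /andP[el er].
have {}pos : 0 < 1 + a * e by lra.
split=> //; rewrite normrM normfV (gtr0_norm pos) ler_pdivrMr //.
  have h1 : 0 <= (1 - a) * (1 - e) by apply: mulr_ge0; lra.
  have h2 : 0 <= (1 + a) * (1 + e) by apply: mulr_ge0; lra.
  by rewrite ler_norml; apply/andP; split; lra.
case: (lerP 0 a) => a0; case: (lerP 0 e) => e0.
- rewrite !ger0_norm ?addr_ge0 //.
  by have := mulr_ge0 (mulr_ge0 a0 e0) (addr_ge0 a0 e0); lra.
- rewrite (ger0_norm a0) (ltr0_norm e0).
  have h0 : 0 <= a * - e by apply: mulr_ge0; lra.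
  have h1 : 0 <= a * - e * (1 + e) by apply: mulr_ge0; lra.
  have h2 : 0 <= a * - e * (1 - a) by apply: mulr_ge0; lra.
  by rewrite ler_norml; apply/andP; split; nra.
- rewrite (ltr0_norm a0) (ger0_norm e0).
  have h0 : 0 <= e * - a by apply: mulr_ge0; lra.
  have h1 : 0 <= e * - a * (1 + a) by apply: mulr_ge0; lra.
  have h2 : 0 <= e * - a * (1 - e) by apply: mulr_ge0; lra.
  by rewrite ler_norml; apply/andP; split; nra.
- rewrite !ltr0_norm //; last by lra.
  have h1 : 0 <= (- a) * (- e) by apply: mulr_ge0; lra.
  have h2 : 0 <= (- a) * (- e) * (- a - e) by apply: mulr_ge0; lra.
  by lra.
Qed.

(** The mean at a leaf with own field [a] and coupling [c] to its parent. [A] is the total weight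
    without the leaf, [M] the same sum weighted by the spin of the parent, and [A + c * a * M] the
    total weight with the leaf. *)
Lemma bias_child (a c th m A M : R) :
    `|a| <= 1 -> `|c| <= th -> th <= 1 -> 0 <= m ->
    `|M| <= A -> `|M| <= m * A ->
  `|a * A + c * M| <= (`|a| + th * m) * (A + c * a * M).
Proof.
move=> a1 cth th1 m0 MA MmA.
have th0 : 0 <= th by apply: le_trans cth.
have A0 : 0 <= A by apply: le_trans MA.
have xA : `|c * M| <= A.
  by rewrite normrM; have := normr_ge0 c; have := normr_ge0 M; nra.
have xt : `|c * M| <= th * m * A.
  by rewrite normrM -mulrA; apply: ler_pM.
have t0 : 0 <= th * m by apply: mulr_ge0.
rewrite mulrAC; move: (c * M) (th * m) xA xt t0 => x t.
(* The case of a nonnegative field, with y for c M and t for th m; negating both [a] and c M reduces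
   the other case to it. *)
have key b y : 0 <= b <= 1 -> `|y| <= A -> `|y| <= t * A -> 0 <= t ->
    `|b * A + y| <= (b + t) * (A + y * b).
  move=> /andP[b0 b1]; rewrite !ler_norml => /andP[y1 y2] /andP[y3 y4] t0.
  case: (lerP 0 y) => y0.
    have h1 := mulr_ge0 t0 (mulr_ge0 y0 b0).
    have h2 := mulr_ge0 (mulr_ge0 b0 b0) y0.
    have h3 := mulr_ge0 b0 A0; have h4 := mulr_ge0 t0 A0.
    by apply/andP; split; nra.
  have h1 : 0 <= A + y * b by nra.
  have h2 : 0 <= b * (A + y * b) by apply: mulr_ge0.
  have h3 : 0 <= t * (A + y * b) by apply: mulr_ge0.
  have bb : 0 <= 1 - b * b by nra.
  apply/andP; split; last by have := mulr_le0_ge0 (ltW y0) bb; nra.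
  case: (lerP t 1) => t1.
    have : 0 <= (1 - t) * (b * - y) by rewrite !mulr_ge0 // ?subr_ge0 // oppr_ge0 ltW.
    by nra.
  have : 0 <= (t - 1) * (A + y * b) by rewrite mulr_ge0 // subr_ge0 ltW.
  by nra.
move=> xA xt t0; case: (lerP 0 a) => a0.
  by rewrite (ger0_norm a0) in a1 *; rewrite key ?a0.
rewrite (ltr0_norm a0) in a1 *.
have := key (- a) (- x); rewrite !normrN mulrNN mulNr -opprD normrN.
by apply=> //; rewrite a1 oppr_ge0 ltW.
Qed.

(** One step of belief propagation: the spin at the leaf [l] is summed out. The mean at [l] itself
    comes from [bias_child]; for any other vertex the leaf acts as an extra field [c * a l] on its
    parent [p], and the bound for [Psi] applies. *)
Lemma bias_bound_leaf K K' Psi l p (c th : R) :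
    bias_bound K Psi -> (forall s, Psi (flip_at l s) = Psi s) ->
    (forall s, 0 <= Psi s) -> (forall w v, 0 <= K w v) ->
    p != l -> `|c| <= th -> th < 1 ->
    K' l l = 1 -> (forall v, v != l -> K' l v = th * K p v) ->
    (forall w, w != l -> K' w l = th * K w p) ->
    (forall w v, w != l -> v != l -> K' w v = K w v) ->
  bias_bound K' (fun s => Psi s * (1 + c * spin (s p) * spin (s l))).
Proof.
move=> bK Pl P0 K0 pl cth th1 K'll K'l K'r K'E a v a1.
pose a0 w := if w == l then 0 else a w.
have a01 w : `|a0 w| <= 1 by rewrite /a0; case: eqP; rewrite ?normr0 ?ler01.
have fE s : field a s = (1 + a l * spin (s l)) * field a0 s.
  by rewrite field_away -fieldD1.
(* The part odd in the spin at [l] sums to zero. *)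
have out (f g : {ffun V -> bool} -> R) : (forall s, f (flip_at l s) = f s) ->
    (forall s, g (flip_at l s) = g s) ->
    \sum_s (Psi s * field a0 s) * (f s + g s * spin (s l))
      = \sum_s (Psi s * field a0 s) * f s.
  move=> fl gl.
  rewrite -[RHS]addr0 -[X in _ = _ + X](@sum_spin0
     (fun s => Psi s * field a0 s * g s) l) => [|s].
    by rewrite -big_split /=; apply: eq_bigr => s _; ring.
  by rewrite Pl gl field_flip.
have flp s : flip_at l s p = s p by rewrite ffunE (negPf pl) addbF.
have ZE : \sum_s Psi s * (1 + c * spin (s p) * spin (s l)) * field a s
    = \sum_s (Psi s * field a0 s) * (1 + c * a l * spin (s p)).
  rewrite -(out _ (fun s => a l + c * spin (s p))) => [|s|s]; rewrite ?flp //.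
  apply: eq_bigr => s _; rewrite fE; have := spin_sqr (s l).
  move: (spin (s l)) (spin (s p)) (Psi s) (field a0 s) => x y P f xx.
  transitivity (P * f * (1 + (a l + c * y) * x + c * y * a l * (x * x))); first by ring.
  by rewrite xx; ring.
rewrite ZE.
have [->|vl] := eqVneq v l.
  have -> : \sum_s Psi s * (1 + c * spin (s p) * spin (s l)) * field a s * spin (s l)
    = \sum_s (Psi s * field a0 s) * (a l + c * spin (s p)).
    rewrite -(out _ (fun s => 1 + c * a l * spin (s p))) => [|s|s]; rewrite ?flp //.
    apply: eq_bigr => s _; rewrite fE; have := spin_sqr (s l).
    move: (spin (s l)) (spin (s p)) (Psi s) (field a0 s) => x y P f xx.
    transitivity (P * f * (x + (a l + c * y) * (x * x) + c * y * a l * x * (x * x))); first by ring.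
    by rewrite xx; ring.
  pose A := \sum_s Psi s * field a0 s.
  pose M := \sum_s Psi s * field a0 s * spin (s p).
  have -> : \sum_s (Psi s * field a0 s) * (a l + c * spin (s p)) = a l * A + c * M.
    by rewrite !mulr_sumr -big_split; apply: eq_bigr => s _ /=; ring.
  have -> : \sum_s (Psi s * field a0 s) * (1 + c * a l * spin (s p)) = A + c * a l * M.
    by rewrite mulr_sumr -big_split; apply: eq_bigr => s _ /=; ring.
  have -> : \sum_w `|a w| * K' w l = `|a l| + th * \sum_w `|a0 w| * K w p.
    rewrite (bigD1 l) //= K'll mulr1; congr (_ + _).
    rewrite [in RHS](bigD1 l) //= /a0 eqxx normr0 mul0r add0r mulr_sumr.
    by apply: eq_bigr => w wl; rewrite (negPf wl) K'r //; ring.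
  apply: bias_child => //; first exact: ltW.
  - by apply: sumr_ge0 => w _; rewrite mulr_ge0.
  - apply: le_trans (ler_norm_sum _ _ _) _; apply: ler_sum => s _.
    by rewrite normrM norm_spin mulr1 ger0_norm // mulr_ge0 // field_ge0.
  - exact: bK.
have c1 : `|c * a l| < 1.
  by rewrite normrM; have := a1 l; have := normr_ge0 c; have := normr_ge0 (a l); nra.
have [pos q1 qD] := bias_combine (a1 p) c1.
(* The field left on the other vertices once [l] is summed out; the strict bound [c1] keeps its
   denominator positive. *)
pose a' w := if w == p then (a p + c * a l) / (1 + a p * (c * a l)) else a0 w.
have a'1 w : `|a' w| <= 1 by rewrite /a'; case: eqP.
have f'E s : field a0 s * (1 + c * a l * spin (s p)) = (1 + a p * (c * a l)) * field a' s.
  rewrite !(fieldD1 _ p) /a' eqxx /a0 (negPf pl).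
  rewrite [X in _ = _ * (_ * X)](eq_bigr (fun w => 1 + a0 w * spin (s w))); last first.
    by move=> w /negPf ->.
  have := spin_sqr (s p); move: (spin (s p)) (\prod_(_ | _) _) => x P xx.
  rewrite mulrAC [RHS]mulrA; congr (_ * _).
  rewrite [RHS](_ : _ = 1 + a p * (c * a l) + (a p + c * a l) * x); last first.
    by field; rewrite gt_eqF.
  transitivity (1 + (a p + c * a l) * x + a p * (c * a l) * (x * x)); first by ring.
  by rewrite xx; ring.
have -> : \sum_s Psi s * (1 + c * spin (s p) * spin (s l)) * field a s * spin (s v)
  = (1 + a p * (c * a l)) * \sum_s Psi s * field a' s * spin (s v).
  transitivity (\sum_s (Psi s * field a0 s) * (spin (s v) * (1 + c * a l * spin (s p)))).
    have flv s : flip_at l s v = s v by rewrite ffunE (negPf vl) addbF.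
    rewrite -(out _ (fun s => spin (s v) * (a l + c * spin (s p)))) => [|s|s]; rewrite ?flp ?flv //.
    apply: eq_bigr => s _; rewrite fE; have := spin_sqr (s l).
    move: (spin (s l)) (spin (s p)) (spin (s v)) (Psi s) (field a0 s) => x y z P f xx.
    transitivity (P * f * z * (1 + (a l + c * y) * x + c * y * a l * (x * x))); first by ring.
    by rewrite xx; ring.
  rewrite mulr_sumr; apply: eq_bigr => s _.
  by transitivity (Psi s * spin (s v) * (field a0 s * (1 + c * a l * spin (s p)))); [ring|rewrite f'E; ring].
have -> : \sum_s (Psi s * field a0 s) * (1 + c * a l * spin (s p))
  = (1 + a p * (c * a l)) * \sum_s Psi s * field a' s.
  by rewrite mulr_sumr; apply: eq_bigr => s _; rewrite -mulrA f'E; ring.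
rewrite normrM (gtr0_norm pos) [leRHS]mulrCA ler_pM2l //.
apply: le_trans (bK _ _ a'1) _; apply: ler_wpM2r.
  by apply: sumr_ge0 => s _; rewrite mulr_ge0 // field_ge0.
rewrite (bigD1 p) //= (bigD1 l) 1?eq_sym //=.
rewrite [leRHS](bigD1 p) //= [X in _ <= _ + X](bigD1 l) 1?eq_sym //=.
rewrite (eq_bigr (fun w => `|a w| * K' w v)); last first.
  by move=> w /andP[wp wl]; rewrite /a' /a0 (negPf wp) (negPf wl) K'E.
rewrite !addrA lerD2r /a' eqxx eq_sym (negPf pl) /a0 eqxx normr0 mul0r addr0.
rewrite (K'E p) // K'l // [X in _ <= _ + X]mulrA -mulrDl ler_wpM2r //.
apply: le_trans qD _; rewrite lerD2l normrM mulrC ler_wpM2l //.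
Qed.

Lemma sum_mem_le (F : V -> R) (ws : seq V) : (forall w, 0 <= F w) ->
  \sum_(w | w \in ws) F w <= \sum_(w <- ws) F w.
Proof.
move=> F0; elim: ws => [|x ws IH]; first by rewrite big_nil big_pred0.
rewrite big_cons; apply: le_trans (_ : F x + \sum_(w | w \in ws) F w <= _); last by rewrite lerD2l.
rewrite (bigID (pred1 x)) /= lerD //.
  rewrite (big_pred1 x) // => w /=; rewrite inE andbC.
  by case: eqP => //= ->; rewrite eqxx.
rewrite [leRHS](bigID (pred1 x)) /= -[leLHS]add0r lerD ?sumr_ge0 //.
rewrite le_eqVlt; apply/orP; left; apply/eqP; apply: eq_bigl => w; rewrite inE /=.
by case: (w == x) => //=; rewrite andbF.
Qed.

(* Averaging over the spins pinned on u :: ws turns phi into an external field. *)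
Lemma bias_two_point K Psi phi (ws : seq V) u v :
    bias_bound K Psi -> (forall s, 0 <= Psi s) -> (forall w v, 0 <= K w v) ->
    (forall s, 0 <= phi s) ->
    (forall s t, {in ws, s =1 t} -> phi s = phi t) ->
  `|\sum_s Psi s * phi s * spin (s u) * spin (s v)|
    <= (\sum_(w <- u :: ws) K w v) * \sum_s Psi s * phi s.
Proof.
move=> bK P0 K0 phi0 phiW.
(* This field pins the spins on [u :: ws] to those of [t]. Summed over [t], every vertex contributes
   a factor 2, pinned or not. *)
pose a t w := if w \in u :: ws then spin (t w) else 0.
have a1 t w : `|a t w| <= 1 by rewrite /a; case: ifP; rewrite ?norm_spin ?normr0 ?ler01.
have avg s : \sum_(t : {ffun V -> bool}) field (a t) s = 2 ^+ #|V|.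
  rewrite /field -(bigA_distr_bigA
    (fun w b => 1 + (if w \in u :: ws then spin b else 0) * spin (s w))) /=.
  under eq_bigr => w _ do rewrite big_bool /=.
  rewrite (eq_bigr (fun _ => 2)) ?prodr_const // => w _.
  by case: ifP => _; rewrite /spin /= ?expr1 ?expr0; ring.
(* The field vanishes at [s] unless [s] and [t] agree on [u :: ws], so [g] may be evaluated at
   [t]. *)
have pin (g : {ffun V -> bool} -> R) s t : (forall s t, {in u :: ws, s =1 t} -> g s = g t) ->
    g s * field (a t) s = g t * field (a t) s.
  move=> gW; have [/allP st|] := boolP (all (fun w => s w == t w) (u :: ws)).
    by rewrite (gW s t) // => w /st /eqP.
  case/allPn => w win stw; rewrite (fieldD1 _ w) /a win.
  suff -> : 1 + spin (t w) * spin (s w) = 0 by rewrite mul0r !mulr0.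
  by move: stw; rewrite /spin; case: (s w); case: (t w) => //= _; rewrite ?expr0 ?expr1; ring.
have unavg (g f : {ffun V -> bool} -> R) : (forall s t, {in u :: ws, s =1 t} -> g s = g t) ->
    2 ^+ #|V| * \sum_s f s * g s = \sum_t g t * \sum_s f s * field (a t) s.
  move=> gW; rewrite mulr_sumr.
  transitivity (\sum_s \sum_t f s * (g t * field (a t) s)).
    apply: eq_bigr => s _; rewrite -mulr_sumr -(eq_bigr _ (fun t _ => pin g s t gW)).
    by rewrite -mulr_sumr avg; ring.
  rewrite exchange_big; apply: eq_bigr => t _; rewrite mulr_sumr.
  by apply: eq_bigr => s _; ring.
have phiT s t : {in u :: ws, s =1 t} -> phi s = phi t.
  by move=> st; apply: phiW => w wW; apply: st; rewrite inE wW orbT.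
have two0 : 0 < 2 ^+ #|V| :> R by rewrite exprn_gt0 // ltr0n.
rewrite -(ler_pM2l two0) -{1}(gtr0_norm two0) -normrM.
rewrite (eq_bigr (fun s => (Psi s * spin (s v)) * (phi s * spin (s u)))); last by move=> s _; ring.
rewrite unavg; last first.
  by move=> s t st; rewrite (phiT s t) // st // inE eqxx.
rewrite mulrCA unavg // mulr_sumr.
apply: le_trans (ler_norm_sum _ _ _) _; apply: ler_sum => t _.
rewrite normrM normrM norm_spin mulr1 (ger0_norm (phi0 t)) mulrCA ler_wpM2l //.
rewrite (eq_bigr (fun s => Psi s * field (a t) s * spin (s v))); last by move=> s _; ring.
apply: le_trans (bK (a t) v (a1 t)) _; apply: ler_wpM2r.
  by apply: sumr_ge0 => s _; rewrite mulr_ge0 // field_ge0.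
apply: le_trans (sum_mem_le _ _) => //.
rewrite [leLHS](bigID (mem (u :: ws))) /= [X in _ + X]big1 ?addr0 => [|w /negPf]; last first.
  by rewrite /a => ->; rewrite normr0 mul0r.
by apply: ler_sum => w wW; rewrite /a wW norm_spin mul1r.
Qed.

End Ising.

(** * The explored graph *)

Section Distance.
Variables (V : eqType) (R : realFieldType).
Implicit Types (D : V -> V -> option nat) (x : R).

Definition kernel x D w v : R := if D w v is Some r then x ^+ r else 0.

(** Forest distances after [l] is hung on [p]; [None] means not connected. *)
Definition graft D l p w v : option nat :=
  if w == l then if v == l then Some 0%N else omap S (D p v)
  else if v == l then omap S (D w p) else D w v.

Lemma kernel_ge0 x D w v : 0 <= x -> 0 <= kernel x D w v.
Proof. by move=> x0; rewrite /kernel; case: (D w v) => // r; exact: exprn_ge0. Qed.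

Lemma kernel_omap x (o : option nat) :
  (if omap S o is Some r then x ^+ r else 0) = x * (if o is Some r then x ^+ r else 0).
Proof. by case: o => [r|] /=; rewrite ?exprS ?mulr0. Qed.

Lemma kernel_graft_ll x D l p : kernel x (graft D l p) l l = 1.
Proof. by rewrite /kernel /graft eqxx expr0. Qed.

Lemma kernel_graft_l x D l p v : v != l -> kernel x (graft D l p) l v = x * kernel x D p v.
Proof. by move=> /negPf vl; rewrite /kernel /graft eqxx vl kernel_omap. Qed.

Lemma kernel_graft_r x D l p w : w != l -> kernel x (graft D l p) w l = x * kernel x D w p.
Proof. by move=> /negPf wl; rewrite /kernel /graft eqxx wl kernel_omap. Qed.

Lemma kernel_graft_old x D l p w v : w != l -> v != l ->
  kernel x (graft D l p) w v = kernel x D w v.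
Proof. by move=> /negPf wl /negPf vl; rewrite /kernel /graft wl vl. Qed.

(** Up to distance r the kernel is at most 1, hence at most m^(r - dist); beyond r it is at most
    x^r. *)
Lemma kernel_le x m D r w v : 0 <= x -> x <= 1 -> 1 <= m ->
  kernel x D w v <= m ^+ r * kernel m^-1 D w v + x ^+ r * (D w v != None)%:R.
Proof.
move=> x0 x1 m1; rewrite /kernel; case: (D w v) => [q|] /=; last by rewrite !mulr0 addr0.
have m0 : 0 < m by apply: lt_le_trans m1.
rewrite mulr1; case: (leqP q r) => [qr|rq].
  apply: le_trans (_ : 1 <= _); first exact: exprn_ile1.
  rewrite -[r in m ^+ r](subnK qr) exprD -mulrA -exprMn divff ?gt_eqF // expr1n mulr1.
  rewrite -[leLHS]addr0 lerD ?exprn_ege1 ?exprn_ge0 //.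
rewrite -[leLHS]add0r lerD ?mulr_ge0 ?exprn_ge0 ?invr_ge0 ?(ltW m0) //.
by apply: ler_wiXn2l => //; exact: ltnW.
Qed.

End Distance.

(** * Invariants of the exploration *)

Section Exploration.
Variables (n d : nat) (R : realFieldType) (th : R).
Hypotheses (d2 : (2 <= d)%N) (th0 : 0 <= th) (th1 : th < 1).
Implicit Types (s : seq (entry n d)) (h : half n d) (t : {ffun 'I_n -> bool}).
Implicit Types (D : 'I_n -> 'I_n -> option nat) (W : seq 'I_n).

Definition seen s : seq 'I_n := [seq h.1 | h <- touched s].

(** For [th] = 1 - 2 eps, twice the NO probability of the label given the spins
    ([edge_law_spin]). *)
Definition edge_factor (e : entry n d) t : R :=
  1 + th * spin R e.2 * spin R (t e.1.1.1) * spin R (t e.1.2.1).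

Definition weight s t : R := \prod_(e <- s) edge_factor e t.

Definition free_slots s v := (\sum_(i < d) ((v, i) \notin touched s))%N.

Lemma edge_factor_ge0 e t : 0 <= edge_factor e t.
Proof.
rewrite /edge_factor -lerBlDl sub0r.
suff : `|th * spin R e.2 * spin R (t e.1.1.1) * spin R (t e.1.2.1)| <= 1.
  by rewrite ler_norml => /andP[].
by rewrite !normrM !norm_spin !mulr1 ger0_norm // ltW.
Qed.

(* Psi is the weight of the forest of discovery edges, whose distances are
   recorded in D; phi is the weight of the collision edges, i.e. those leading
   to an already seen vertex, whose endpoints are listed in W.
   ex_growth survives the addition of a leaf l to p because l brings weight
   kernel w p / d times 1 + (d - 1), while p loses one free slot. *)
Record explored s W D (Psi phi : {ffun 'I_n -> bool} -> R) : Prop := Explored {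
  ex_uniq : uniq (touched s);
  ex_weight : forall t, weight s t = Psi t * phi t;
  ex_Psi_ge0 : forall t, 0 <= Psi t;
  ex_phi_ge0 : forall t, 0 <= phi t;
  ex_Psi_flip : forall v, v \notin seen s -> forall t, Psi (flip_at v t) = Psi t;
  ex_phi_dep : forall t t', {in W, t =1 t'} -> phi t = phi t';
  ex_W_seen : {subset W <= seen s};
  ex_far : forall w v, v \notin seen s -> w != v -> D w v = None;
  ex_growth : forall w,
    \sum_v kernel (d%:R^-1 : R) D w v * (1 + free_slots s v)%:R <= (2 * d)%:R;
  ex_bias : bias_bound (kernel th D) Psi }.

Lemma free_slots_le s v : (free_slots s v <= d)%N.
Proof.
rewrite -[leqRHS](card_ord d) -sum1_card; apply: leq_sum => i _.
by case: (_ \notin _).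
Qed.

Lemma free_slots_cons s e v : (free_slots (e :: s) v <= free_slots s v)%N.
Proof.
apply: leq_sum => i _; rewrite /= !inE !negb_or.
by case: (_ \notin _); rewrite ?andbF //; case: (_ && _).
Qed.

Lemma free_slots_used s e h : h \in [:: e.1.1; e.1.2] -> h \notin touched s ->
  (free_slots (e :: s) h.1 < free_slots s h.1)%N.
Proof.
move=> he hs; rewrite /free_slots (bigD1 h.2) //= [ltnRHS](bigD1 h.2) //=.
rewrite -surjective_pairing hs.
have -> : h \in [:: e.1.1, e.1.2 & touched s] by rewrite (mem_cat _ [:: e.1.1; e.1.2]) he.
rewrite add0n add1n ltnS; apply: leq_sum => i _; rewrite !inE !negb_or.
by case: (_ \notin _); rewrite ?andbF //; case: (_ && _).
Qed.

Lemma explored_nil :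
  explored [::] [::] (fun w v => if w == v then Some 0%N else None) (fun _ => 1) (fun _ => 1).
Proof.
split=> //.
- by move=> t; rewrite /weight big_nil mulr1.
- by move=> w v _ /negPf ->.
- move=> w; rewrite (bigD1 w) //= big1 ?addr0 /kernel => [|v /negPf vw]; last first.
    by rewrite eq_sym vw mul0r.
  rewrite eqxx expr0 mul1r ler_nat mul2n -addnn leq_add ?free_slots_le //.
  exact: leq_trans d2.
- move=> a v a1; have := bias_bound_free v a1.
  rewrite (eq_bigr (fun w => `|a w| * kernel th (fun w v => if w == v then Some 0%N else None) w v)) //.
  by move=> w _; rewrite /kernel; case: (w == v); rewrite ?expr0.
Qed.

(** The new vertex [h'.1] is isolated in the forest, so [Psi] ignores its spin and [bias_bound_leaf]
    applies. If [h.1] is unseen as well, a new tree starts: every vertex has distance 0 to itself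
    from the outset. *)
Lemma explored_leaf s W D Psi phi h h' b :
    explored s W D Psi phi -> h \notin touched s -> h' \notin touched s ->
    h'.1 \notin h.1 :: seen s ->
  let e := (h, h', b) in
  explored (e :: s) W (graft D h'.1 h.1) (fun t => Psi t * edge_factor e t) phi.
Proof.
move=> [us wE P0 phi0 Pflip phiW Ws far growth bias] hs h's.
rewrite inE negb_or => /andP[h'h h'new] e.
have hh' : h.1 != h'.1 by rewrite eq_sym.
have dR : 0 < d%:R :> R by rewrite ltr0n; exact: leq_trans d2.
have di : 0 <= d%:R^-1 :> R by rewrite invr_ge0 ltW.
split=> //.
- rewrite /= inE negb_or hs h's us !andbT /=.
  by apply: contraNneq hh' => ->.
- by move=> t; rewrite /weight big_cons -/(weight s t) wE; ring.
- by move=> t; rewrite mulr_ge0 // edge_factor_ge0.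
- move=> v; rewrite /seen /= !inE !negb_or => /and3P[vh vh' vs] t.
  rewrite Pflip // /edge_factor /= !ffunE ![_ == v]eq_sym.
  by rewrite (negPf vh) (negPf vh') !addbF.
- by move=> w /Ws; rewrite /seen /= !inE => ->; rewrite !orbT.
- move=> w v; rewrite /seen /= !inE !negb_or => /and3P[vh vh' vs] wv.
  rewrite /graft (negPf vh') (far w) //.
  by case: eqP => // _; rewrite far // 1?eq_sym.
- have fS v : ((1 + free_slots (e :: s) v)%:R : R) <= (1 + free_slots s v)%:R.
    by rewrite ler_nat leq_add2l free_slots_cons.
  have fl : (1 + free_slots (e :: s) h'.1)%:R <= d%:R :> R.
    rewrite ler_nat add1n; apply: leq_trans (free_slots_used _ h's) _.
      by rewrite !inE eqxx orbT.
    exact: free_slots_le.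
  have fp : (1 + free_slots (e :: s) h.1)%:R + 1 <= (1 + free_slots s h.1)%:R :> R.
    rewrite -[X in _ + X]/(1%:R) -natrD ler_nat addn1 !add1n ltnS.
    by rewrite free_slots_used // !inE eqxx.
  (* From the leaf itself: its own term is at most d, the others at most (2 d) / d = 2 through the
     parent, and d + 2 <= 2 d. From any other vertex, the term of the leaf is paid by the slot lost
     at the parent. *)
  move=> w; rewrite (bigD1 h'.1) //=; have [->|wl] := eqVneq w h'.1.
    rewrite kernel_graft_ll mul1r.
    apply: le_trans (_ : d%:R + 2 <= _); last by rewrite -natrD ler_nat mul2n -addnn leq_add2l.
    rewrite lerD //.
    apply: le_trans (_ : d%:R^-1 *
      \sum_v kernel (d%:R^-1 : R) D h.1 v * (1 + free_slots s v)%:R <= _); last first.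
      by rewrite mulrC ler_pdivrMr // -natrM growth.
    rewrite mulr_sumr [leRHS](bigD1 h'.1) //= -[leLHS]add0r lerD //.
      by rewrite !mulr_ge0 ?kernel_ge0 ?ler0n.
    apply: ler_sum => v vl; rewrite kernel_graft_l // -mulrA ler_wpM2l //.
    by rewrite ler_wpM2l ?kernel_ge0.
  apply: le_trans (growth w); rewrite kernel_graft_r //.
  rewrite (bigD1 h.1) //= [leRHS](bigD1 h'.1) //= [X in _ <= _ + X](bigD1 h.1) //=.
  rewrite kernel_graft_old // !addrA; apply: lerD; last first.
    apply: ler_sum => v /andP[vl vp]; rewrite kernel_graft_old //.
    by rewrite ler_wpM2l ?kernel_ge0.
  set k := kernel _ D w h.1; have k0 : 0 <= k by exact: kernel_ge0.
  apply: le_trans (_ : k * ((1 + free_slots (e :: s) h.1)%:R + 1) <= _).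
    rewrite mulrDr mulr1 addrC lerD2l mulrAC mulrC -[leRHS]mulr1 ler_wpM2l //.
    by rewrite mulrC ler_pdivrMr // mul1r.
  rewrite -[leLHS]add0r lerD ?mulr_ge0 ?kernel_ge0 ?ler0n //.
  by rewrite ler_wpM2l.
- have th_norm : `|th * spin R b| <= th by rewrite normrM norm_spin mulr1 ger0_norm.
  apply: (bias_bound_leaf (l := h'.1) (p := h.1) (th := th) bias (Pflip _ h'new)) => //.
  + by move=> w v; exact: kernel_ge0.
  + exact: kernel_graft_ll.
  + by move=> v; exact: kernel_graft_l.
  + by move=> v; exact: kernel_graft_r.
  + by move=> w v; exact: kernel_graft_old.
Qed.

(** The forest stays as it is; the new factor joins [phi], at the price of two more pinned vertices.
    Self-loops are covered. *)
Lemma explored_collision s W D Psi phi h h' b :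
    explored s W D Psi phi -> h \notin touched s -> h' \notin touched s -> h' != h ->
  let e := (h, h', b) in
  explored (e :: s) [:: h.1, h'.1 & W] D Psi (fun t => phi t * edge_factor e t).
Proof.
move=> [us wE P0 phi0 Pflip phiW Ws far growth bias] hs h's h'h e.
split=> //.
- by rewrite /= inE negb_or hs h's us !andbT /= eq_sym.
- by move=> t; rewrite /weight big_cons -/(weight s t) wE; ring.
- by move=> t; rewrite mulr_ge0 // edge_factor_ge0.
- by move=> v; rewrite /seen /= !inE !negb_or => /and3P[_ _ vs] t; exact: Pflip.
- move=> t t' tt'; rewrite (phiW t t') => [|w wW]; last by rewrite tt' // !inE wW !orbT.
  by rewrite /edge_factor /= !tt' // !inE eqxx ?orbT.
- move=> w; rewrite /seen /= !inE => /or3P[->|->|/Ws]; rewrite ?orbT //.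
  by rewrite /seen => ->; rewrite !orbT.
- by move=> w v; rewrite /seen /= !inE !negb_or => /and3P[_ _ vs]; exact: far.
- move=> w; apply: le_trans (growth w); apply: ler_sum => v _.
  rewrite ler_wpM2l ?kernel_ge0 ?invr_ge0 ?ler0n //.
  by rewrite ler_nat leq_add2l free_slots_cons.
Qed.

Lemma sum_untouched s (F : 'I_n -> R) :
  \sum_(h | h \notin touched s) F h.1 = \sum_v (free_slots s v)%:R * F v.
Proof.
transitivity (\sum_v \sum_(i < d) if (v, i) \notin touched s then F v else 0).
  by rewrite pair_bigA big_mkcond; apply: eq_bigr => -[v i] _.
apply: eq_bigr => v _; rewrite natr_sum mulr_suml; apply: eq_bigr => i _.
by case: (_ \notin _); rewrite ?mul1r ?mul0r.
Qed.

Lemma sum_untouched_mem s (ws : seq 'I_n) :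
  \sum_(h | h \notin touched s) (h.1 \in ws)%:R <= (d * size ws)%:R :> R.
Proof.
rewrite (sum_untouched s (fun v => (v \in ws)%:R)).
apply: le_trans (_ : \sum_(v | v \in ws) d%:R <= _).
  rewrite [leRHS]big_mkcond; apply: ler_sum => v _.
  by case: (v \in ws); rewrite ?mulr1 ?mulr0 // ler_nat free_slots_le.
apply: le_trans (sum_mem_le _ _) _ => //.
by rewrite big_const_seq count_predT iter_addr_0 natrM mulr_natr.
Qed.

(** [kernel_le] with base d: the near part is bounded by [ex_growth]; the far part is th^r for each
    free half-edge at [u] or a seen vertex, as [D] is [None] elsewhere. *)
Lemma kernel_sum s W D Psi phi u w r :
    explored s W D Psi phi -> w \in u :: W ->
  \sum_(h | h \notin touched s) kernel th D w h.1
    <= d%:R ^+ r * (2 * d)%:R + th ^+ r * (d * (2 * size s).+1)%:R.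
Proof.
move=> ex wW; have di : 0 <= d%:R^-1 :> R by rewrite invr_ge0 ler0n.
have d1 : 1 <= d%:R :> R by rewrite ler1n; exact: leq_trans d2.
apply: le_trans (_ : \sum_(h | h \notin touched s)
    (d%:R ^+ r * kernel (d%:R^-1 : R) D w h.1 + th ^+ r * (h.1 \in u :: seen s)%:R) <= _).
  apply: ler_sum => h _; apply: le_trans (kernel_le D r w h.1 th0 (ltW th1) d1) _.
  rewrite lerD2l ler_wpM2l ?exprn_ge0 // ler_nat.
  case: (boolP (h.1 \in _)) => [_|]; first by case: (_ != _).
  rewrite inE negb_or => /andP[hu hs]; rewrite (ex_far ex) //.
  apply: contraNneq hu => wh; move: wW; rewrite wh inE => /predU1P[->//|].
  by move=> /(ex_W_seen ex); rewrite (negPf hs).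
rewrite big_split /= -!mulr_sumr lerD // ler_wpM2l ?exprn_ge0 ?ler0n //.
  apply: le_trans (ex_growth ex w); rewrite sum_untouched; apply: ler_sum => v _.
  by rewrite mulrC ler_wpM2l ?kernel_ge0 // ler_nat leq_addl.
by apply: le_trans (sum_untouched_mem _ _) _; rewrite /= size_map size_touched.
Qed.

End Exploration.

(** * Distinguishing advantage of a decision tree *)

Section Distinguish.
Variables (n d : nat) (R : realFieldType) (eps : R).
Implicit Types (p : pairing n d) (y : labels n d) (h : half n d).
Implicit Types (s : seq (entry n d)) (F : pairing n d -> labels n d -> R).

(** This and the next weights restate the laws of the instance over an arbitrary real field;
    [success_probE] identifies the two versions. *)
Definition pairing_weight p : R :=
  if is_matching p then #|[pred q : pairing n d | is_matching q]|%:R^-1 else 0.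

Definition yes_weight p y : R :=
  if consistent p y then #|[pred z : labels n d | consistent p z]|%:R^-1 else 0.

Definition edge_law (X : {ffun 'I_n -> bool}) (u v : 'I_n) b : R :=
  if b == X u (+) X v then 1 - eps else eps.

Definition no_weight p y : R :=
  if consistent p y then
    \sum_(X : {ffun 'I_n -> bool})
      ((2 ^+ n)^-1 * \prod_(h | edge_rep p h) edge_law X h.1 (p h).1 (y h))
  else 0.

Local Notation th := (1 - 2 * eps).

(* The NO/YES likelihood ratio of the revealed labelled edges. *)
Definition gain s : R := (2 ^+ n)^-1 * \sum_X weight th s X.

Lemma edge_law_spin X (e : entry n d) :
  edge_law X e.1.1.1 e.1.2.1 e.2 = 2^-1 * edge_factor th e X.
Proof.
rewrite /edge_law /edge_factor /spin.
by case: e.2; case: (X e.1.1.1); case: (X e.1.2.1) => /=; rewrite ?expr0 ?expr1; field.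
Qed.

Lemma prod_seq_const (T : Type) (l : seq T) (c : R) : \prod_(x <- l) c = c ^+ size l.
Proof. by elim: l => [|x l IH]; [rewrite big_nil | rewrite big_cons IH exprS]. Qed.

(** [label_mass] with all factors 1/2; its case of an empty list identifies the constant product
    with the uniform weight. *)
Lemma yes_weight_mass p s :
    is_matching p -> agrees_pairing p s -> uniq (touched s) ->
  \sum_(y | agrees_labels y s) yes_weight p y = 2^-1 ^+ size s.
Proof.
move=> pM ps us.
have g1 (h : half n d) : \sum_(b : bool) 2^-1 = 1 :> R.
  by rewrite big_bool /=; field.
pose c : R := \prod_(h | edge_rep p h) 2^-1.
have mass s' : agrees_pairing p s' -> uniq (touched s') ->
    \sum_(y : labels n d | consistent p y && agrees_labels y s') c = 2^-1 ^+ size s'.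
  move=> ps' us'; rewrite (label_mass pM (g := fun _ _ => 2^-1) ps' us') //.
  by rewrite big_const_seq count_predT /=; elim: (size s') => //= k ->; rewrite exprS.
have cE : c = #|[pred z : labels n d | consistent p z]|%:R^-1.
  set k := #|_|; have cM : c * k%:R = 1.
    transitivity (\sum_(y : labels n d | consistent p y && agrees_labels y [::]) c).
      rewrite sumr_const -[RHS]mulr_natr; congr (c * _%:R); apply: eq_card => z.
      by rewrite [RHS]unfold_in andbT.
    by rewrite mass // expr0.
  have k0 : k%:R != 0 :> R.
    by apply: contraTneq isT => k0; move: cM => /eqP; rewrite k0 mulr0 eq_sym oner_eq0.
  by apply: (mulIf k0); rewrite cM mulVf.
rewrite -(mass s ps us) big_mkcond [RHS]big_mkcond; apply: eq_bigr => y _.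
by rewrite /yes_weight -cE; case: (consistent p y); case: (agrees_labels y s).
Qed.

(** For fixed spins [X] the labels are independent and [label_mass] applies; averaging over [X] then
    produces [gain]. *)
Lemma no_weight_mass p s :
    is_matching p -> agrees_pairing p s -> uniq (touched s) ->
  \sum_(y | agrees_labels y s) no_weight p y = 2^-1 ^+ size s * gain s.
Proof.
move=> pM ps us.
transitivity (\sum_(y : labels n d | consistent p y && agrees_labels y s)
  \sum_(X : {ffun 'I_n -> bool})
      ((2 ^+ n)^-1 * \prod_(h | edge_rep p h) edge_law X h.1 (p h).1 (y h))).
  rewrite big_mkcond [RHS]big_mkcond; apply: eq_bigr => y _.
  by rewrite /no_weight; case: (consistent p y); case: (agrees_labels y s).
rewrite exchange_big /gain mulrCA !mulr_sumr; apply: eq_bigr => X _.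
rewrite -mulr_sumr; congr (_ * _).
rewrite (label_mass pM (g := fun h b => edge_law X h.1 (p h).1 b) ps us); first last.
- move=> h; rewrite big_bool /edge_law; by case: (_ (+) _) => /=; ring.
- by move=> h b; rewrite matchingK // /edge_law addbC.
rewrite /weight -prod_seq_const -big_split /=.
rewrite big_seq [RHS]big_seq; apply: eq_bigr => e es.
by rewrite -edge_law_spin; have /allP/(_ e es)/eqP -> := ps.
Qed.

(** NO minus YES expectation of [F], restricted to the instances that agree with [s]. *)
Definition total s F : R :=
  \sum_(p | agrees_pairing p s) \sum_(y | agrees_labels y s)
     pairing_weight p * (no_weight p y - yes_weight p y) * F p y.

(** The YES probability of agreeing with [s] when its half-edges are distinct; the NO probability is
    then [yes_mass s * gain s]. *)
Definition yes_mass s : R :=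
  (num_ext s)%:R * #|[pred q : pairing n d | is_matching q]|%:R^-1 * 2^-1 ^+ size s.

Lemma yes_mass_ge0 s : 0 <= yes_mass s.
Proof. by rewrite !mulr_ge0 ?invr_ge0 ?exprn_ge0 ?ler0n ?invr_ge0 ?ler0n. Qed.

Lemma total_const s F c : uniq (touched s) -> (forall p y, F p y = c) ->
  total s F = c * yes_mass s * (gain s - 1).
Proof.
move=> us FE; rewrite /total.
rewrite (eq_bigr (fun p => if is_matching p then
    c * #|[pred q : pairing n d | is_matching q]|%:R^-1 * 2^-1 ^+ size s * (gain s - 1)
    else 0)); last first.
  move=> p ps; rewrite /pairing_weight; case: ifP => pM; last first.
    by apply: big1 => y _; rewrite !mul0r.
  under eq_bigr => y _ do rewrite FE -mulrA.
  rewrite -mulr_sumr -mulr_suml sumrB no_weight_mass // yes_weight_mass //; ring.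
rewrite -big_mkcondr sumr_const /yes_mass -mulr_natr.
have -> : #|[pred p | agrees_pairing p s & is_matching p]| = num_ext s.
  by apply: eq_card => p; rewrite !inE andbC.
by ring.
Qed.

Lemma eq_total s F F' :
    (forall p y, is_matching p -> consistent p y -> agrees_pairing p s ->
      agrees_labels y s -> F p y = F' p y) ->
  total s F = total s F'.
Proof.
move=> FF'; apply: eq_bigr => p ps; apply: eq_bigr => y ys.
rewrite /pairing_weight /no_weight /yes_weight.
case: (boolP (is_matching p)) => pM; last by rewrite !mul0r.
case: (boolP (consistent p y)) => yC; last by rewrite subr0 mulr0 !mul0r.
by rewrite FF'.
Qed.

Lemma total_query s h (Q : half n d -> bool -> pairing n d -> labels n d -> R) :
    h \notin touched s ->
  total s (fun p y => Q (p h) (y h) p y)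
  = \sum_(h' | (h' \notin touched s) && (h' != h)) \sum_b total ((h, h', b) :: s) (Q h' b).
Proof.
move=> hs.
transitivity (\sum_h' \sum_b total ((h, h', b) :: s) (Q h' b)).
  rewrite /total (partition_big (fun p : pairing n d => p h) predT) //=.
  apply: eq_bigr => h' _; rewrite [RHS]exchange_big /=.
  apply: eq_big => [p|p /andP[ps /eqP ph]]; first by rewrite andbC.
  rewrite (partition_big (fun y : labels n d => y h) predT) //=.
  apply: eq_bigr => b _; apply: eq_big => [y|y /andP[_ /eqP yh]]; first by rewrite andbC.
  by rewrite ph yh.
rewrite (bigID (fun h' => (h' \notin touched s) && (h' != h))) /= [X in _ + X]big1 ?addr0 //.
move=> h' bad; apply: big1 => b _; rewrite /total big1 // => p /= /andP[/eqP ph ps].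
apply: big1 => y _; rewrite /pairing_weight; case: ifP => pM; last by rewrite !mul0r.
by case/negP: bad; rewrite -ph agrees_pairing_untouched // matching_neq.
Qed.

(** Trees are represented by the functions that they compute, so the continuation [Q] may still
    depend on the instance. A constant is a tree of any depth, so branches may stop early. *)
Inductive decision_tree : nat -> (pairing n d -> labels n d -> R) -> Prop :=
| DTconst j c F : `|c| <= 1 -> (forall p y, F p y = c) -> decision_tree j F
| DTquery j h Q F :
    (forall h' b, decision_tree j (Q h' b)) ->
    (forall p y, F p y = Q (p h) (y h) p y) -> decision_tree j.+1 F.

(** * Growth of the likelihood ratio along a tree *)

Section Bound.
Hypotheses (d2 : (2 <= d)%N) (eps0 : 0 < eps) (eps1 : 2 * eps <= 1).
Variables (J r : nat).
Hypothesis (Jn : (2 * J < n * d)%N).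

(** [slack] is a lower bound for the number of possible partners. At most 2 d J of them sit at seen
    vertices, each collision adding 2 to [size W]: this gives [coll]. [near] bounds the mean of the
    kernel at a random partner ([kernel_sum]). *)
Let slack : R := (n * d - 2 * J)%:R.
Let coll : R := (4 * d * J)%:R / slack.
Let near : R := (d%:R ^+ r * (2 * d)%:R + th ^+ r * (2 * d * J)%:R) / slack.

Let th_ge0 : 0 <= th. Proof. by rewrite subr_ge0. Qed.
Let th_lt1 : th < 1. Proof. by rewrite gtrBl mulr_gt0. Qed.
Let slack_gt0 : 0 < slack. Proof. by rewrite ltr0n subn_gt0. Qed.
Let coll_ge0 : 0 <= coll. Proof. by rewrite divr_ge0 ?ler0n. Qed.
Let near_ge0 : 0 <= near.
Proof. by rewrite divr_ge0 ?ler0n // addr_ge0 ?mulr_ge0 ?exprn_ge0 ?ler0n. Qed.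

Let sum_ge0 (a b : nat) : 0 <= a%:R + b%:R * coll + 1.
Proof. by apply: addr_ge0 => //; apply: addr_ge0; [|apply: mulr_ge0]; rewrite ?ler0n. Qed.
Let bracket_ge0 (a b c : nat) : 0 <= c%:R * (a%:R + b%:R * coll + 1) * near.
Proof. by apply: mulr_ge0 => //; apply: mulr_ge0; rewrite ?ler0n. Qed.

Lemma gain_ge0 s : 0 <= gain s.
Proof.
rewrite mulr_ge0 ?invr_ge0 ?exprn_ge0 ?ler0n //; apply: sumr_ge0 => X _.
by apply: prodr_ge0 => e _; exact: edge_factor_ge0.
Qed.

Definition correlation s (u v : 'I_n) : R :=
  (2 ^+ n)^-1 * \sum_X weight th s X * spin R (X u) * spin R (X v).

(** The two labels move [gain] by opposite amounts, so it is a martingale under the YES law. *)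
Lemma gain_cons s h h' b :
  gain ((h, h', b) :: s) = gain s + th * spin R b * correlation s h.1 h'.1.
Proof.
rewrite /gain /correlation mulrCA -mulrDr; congr (_ * _).
rewrite mulr_sumr -big_split; apply: eq_bigr => X _.
by rewrite /= /weight big_cons /edge_factor /=; ring.
Qed.

Lemma correlation_le s W D Psi phi u v : explored th s W D Psi phi ->
  `|correlation s u v| <= (\sum_(w <- u :: W) kernel th D w v) * gain s.
Proof.
move=> ex; rewrite /correlation /gain normrM ger0_norm ?invr_ge0 ?exprn_ge0 //.
rewrite [leRHS]mulrCA ler_wpM2l ?invr_ge0 ?exprn_ge0 //.
have sumE : \sum_X weight th s X = \sum_X Psi X * phi X.
  by apply: eq_bigr => X _; rewrite (ex_weight ex).
rewrite sumE; under eq_bigr => X _ do rewrite (ex_weight ex).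
apply: bias_two_point;
  [exact: ex_bias ex | exact: ex_Psi_ge0 ex | | exact: ex_phi_ge0 ex | exact: ex_phi_dep ex].
by move=> w w'; exact: kernel_ge0.
Qed.

Lemma yes_mass_cons s h h' b :
    uniq (touched s) -> h \notin touched s -> h' \notin touched s -> h' != h ->
    ((n * d - 2 * size s).-1 > 0)%N ->
  yes_mass ((h, h', b) :: s) = yes_mass s / (n * d - 2 * size s).-1%:R / 2.
Proof.
move=> us hs h's h'h N0; rewrite /yes_mass (num_ext_cons b us hs h's h'h) natrM /= exprS.
have : (n * d - 2 * size s).-1%:R != 0 :> R by rewrite pnatr_eq0 -lt0n.
move: _.-1%:R => x x0; move: #|_|%:R^-1 (_ ^+ _) (num_ext _)%:R => *.
by field.
Qed.

(** Averaging over the answer to one query, with [B] the bound on what follows. The triangle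
    inequality charges the correlation to |gain - 1|, and [near] bounds its mean over the
    partners. *)
Lemma query_bound s W D Psi phi h (Q : half n d -> bool -> R) (B : half n d -> R) :
    explored th s W D Psi phi -> (size s < J)%N -> h \notin touched s ->
    (forall h' b, h' \notin touched s -> h' != h ->
      Q h' b <= yes_mass ((h, h', b) :: s) * `|gain ((h, h', b) :: s) - 1|
        + yes_mass ((h, h', b) :: s) * gain ((h, h', b) :: s) * B h') ->
    \sum_(h' | (h' \notin touched s) && (h' != h)) \sum_b Q h' b
    <= yes_mass s * `|gain s - 1|
       + yes_mass s * gain s * ((size W).+1%:R * near +
          \sum_(h' | (h' \notin touched s) && (h' != h)) B h' / (n * d - 2 * size s).-1%:R).
Proof.
move=> ex sJ hs QB; set N' : R := _.-1%:R.
have us := ex_uniq ex.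
have slack_le : slack <= N'.
  by rewrite ler_nat -subn1 -subnDA leq_sub2l // addn1 ltn_pmul2l.
have N'0 : 0 < N' by apply: lt_le_trans slack_le.
have N'n0 : ((n * d - 2 * size s).-1 > 0)%N by rewrite -(ltr0n R).
have y0 := yes_mass_ge0 s; have g0 := gain_ge0 s.
pose k h' := \sum_(w <- h.1 :: W) kernel th D w h'.1.
apply: le_trans (_ : \sum_(h' | (h' \notin touched s) && (h' != h))
    (yes_mass s / N' * `|gain s - 1| + yes_mass s * gain s * (k h' / N')
      + yes_mass s * gain s * (B h' / N')) <= _).
  apply: ler_sum => h' /andP[h's h'h]; rewrite big_bool /=.
  apply: le_trans (lerD (QB h' true h's h'h) (QB h' false h's h'h)) _.
  rewrite !yes_mass_cons // !gain_cons -/N'.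
  have := correlation_le h.1 h'.1 ex; rewrite -/(k h').
  set c := correlation _ _ _; move=> ck.
  have cn : `|th * c| <= k h' * gain s.
    by rewrite normrM (ger0_norm th_ge0); apply: le_trans ck; rewrite ler_piMl // ltW.
  have sp : spin R true = -1 by rewrite /spin expr1.
  have sm : spin R false = 1 by rewrite /spin expr0.
  have tri (b : R) : b = 1 \/ b = -1 -> `|gain s + th * b * c - 1| <= `|gain s - 1| + k h' * gain s.
    case=> ->; rewrite ?mulr1 ?mulrN1 ?mulNr.
      by rewrite addrAC; apply: le_trans (ler_normD _ _) _; rewrite lerD2l.
    by rewrite addrAC; apply: le_trans (ler_normB _ _) _; rewrite lerD2l.
  have t1 := tri 1 (or_introl erefl); have t2 := tri (-1) (or_intror erefl).
  rewrite sp sm; set q := yes_mass s / N' / 2.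
  have q0 : 0 <= q by rewrite !divr_ge0 // ltW.
  have h1 := ler_wpM2l q0 t1; have h2 := ler_wpM2l q0 t2.
  rewrite [leRHS](_ : _ = q * (2 * (`|gain s - 1| + k h' * gain s) + 2 * gain s * B h')); last first.
    by rewrite /q; field; rewrite gt_eqF.
  (* In the terms with [B] the correlations of the two labels cancel. *)
  have -> : q * `|gain s + th * -1 * c - 1| + q * (gain s + th * -1 * c) * B h' +
       (q * `|gain s + th * 1 * c - 1| + q * (gain s + th * 1 * c) * B h')
    = q * `|gain s + th * -1 * c - 1| + q * `|gain s + th * 1 * c - 1| + q * (2 * gain s * B h') by ring.
  rewrite [leRHS]mulrDr lerD2r.
  rewrite [leRHS](_ : _ = q * (`|gain s - 1| + k h' * gain s)
    + q * (`|gain s - 1| + k h' * gain s)); last by ring.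
  exact: lerD.
rewrite !big_split /= -!mulr_sumr sumr_const.
have -> : #|[pred h' | (h' \notin touched s) & (h' != h)]| = (n * d - 2 * size s).-1.
  rewrite -(card_untouched us) [in RHS](cardD1 h) inE hs /=.
  by apply: eq_card => x; rewrite !inE andbC.
rewrite -addrA lerD //.
  rewrite -mulr_natr -/N' [leLHS](_ : _ = yes_mass s * `|gain s - 1|) //.
  by field; rewrite gt_eqF.
rewrite -mulrDr; apply: ler_wpM2l; first exact: mulr_ge0.
rewrite lerD2r -mulr_suml ler_pdivrMr //.
apply: le_trans (_ : (size W).+1%:R * near * slack <= _); last first.
  by apply: ler_wpM2l => //; rewrite mulr_ge0 ?ler0n.
rewrite -mulrA /near divfK ?gt_eqF // exchange_big /=.
rewrite [leRHS]mulr_natl -[(size W).+1]/(size (h.1 :: W)) -[in leRHS](sum1_size (h.1 :: W)) -sumrMnr.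
rewrite big_seq [leRHS]big_seq; apply: ler_sum => w wW; rewrite mulr1n.
apply: le_trans (_ : \sum_(h' | h' \notin touched s) kernel th D w h'.1 <= _).
  rewrite [leRHS](bigID (fun h' => h' != h)) /= -[leLHS]addr0 lerD //.
  by apply: sumr_ge0 => *; exact: kernel_ge0.
apply: le_trans (kernel_sum d2 th_ge0 th_lt1 r ex wW) _.
rewrite lerD2l; apply: ler_wpM2l; first exact: exprn_ge0.
by rewrite ler_nat -[leqRHS]mulnA [leqRHS]mulnCA leq_mul2l ltn_pmul2l // sJ orbT.
Qed.

(* In one query |gain - 1| grows in mean by at most (size W + 1) * near, and
   size W by at most coll; both means are under the NO law yes_mass * gain. *)
Lemma decision_tree_bound j F : decision_tree j F ->
  forall s W D Psi phi, explored th s W D Psi phi -> (size s + j <= J)%N ->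
  `|total s F| <= yes_mass s * `|gain s - 1|
     + yes_mass s * gain s * (j%:R * ((size W)%:R + j%:R * coll + 1) * near).
Proof.
elim=> {j F} [j c F c1 FE|j h Q F _ IH FE] s W D Psi phi ex sJ.
all: have y0 := yes_mass_ge0 s; have g0 := gain_ge0 s.
  rewrite (total_const (ex_uniq ex) FE) 2!normrM (ger0_norm y0) -[leLHS]addr0.
  apply: lerD; first by rewrite -mulrA ler_piMl // mulr_ge0.
  apply: mulr_ge0; first exact: mulr_ge0.
  exact: bracket_ge0.
rewrite (@eq_total _ _ (fun p y => Q (p h) (y h) p y)); last by move=> p y *; rewrite FE.
(* A touched half-edge has its answer determined by [s], so this query reveals nothing. *)
have [hs|hs] := boolP (h \in touched s).
  have [e es hE] := touchedP hs.
  have [x xE] : exists x, forall p, is_matching p -> agrees_pairing p s -> p h = x.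
    case: hE => ->; [exists e.1.2|exists e.1.1] => p pM /allP/(_ e es)/eqP <- //.
    exact: matchingK.
  rewrite (@eq_total _ _ (Q x e.2)); last first.
    move=> p y pM yC ps ys; rewrite xE //; congr Q.
    have /allP/(_ e es)/eqP <- := ys; case: hE => -> //.
    by rewrite -(consistentE e.1.1 yC); have /allP/(_ e es)/eqP -> := ps.
  apply: le_trans (IH x e.2 s W D Psi phi ex _) _; first by apply: leq_trans sJ; rewrite leq_add2l.
  rewrite lerD2l; apply: ler_wpM2l; first exact: mulr_ge0.
  apply: ler_wpM2r => //.
  apply: ler_pM; rewrite ?ler_nat ?ler0n ?sum_ge0 //.
  by rewrite lerD2r lerD2l ler_wpM2r // ler_nat.
rewrite total_query //.
apply: le_trans (ler_norm_sum _ _ _) _.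
apply: le_trans (_ : \sum_(h' | (h' \notin touched s) && (h' != h))
    \sum_b `|total ((h, h', b) :: s) (Q h' b)| <= _).
  by apply: ler_sum => h' _; exact: ler_norm_sum.
(* The induction hypothesis after partner [h']: a collision lengthens [W] by 2. Counting [h.1] as
   seen makes self-loops collisions. *)
pose B h' := j%:R * ((size W)%:R + 2 * (h'.1 \in h.1 :: seen s)%:R + j%:R * coll + 1) * near.
have sJ' : (size s < J)%N by apply: leq_trans sJ; rewrite addnS ltnS leq_addr.
apply: le_trans (query_bound (B := B) ex sJ' hs _) _.
  move=> h' b h's h'h.
  have sJe : (size ((h, h', b) :: s) + j <= J)%N by rewrite /= addSnnS.
  case: (boolP (h'.1 \in h.1 :: seen s)) => cl.
    apply: le_trans (IH h' b _ _ _ _ _ (explored_collision th_ge0 th_lt1 b ex hs h's h'h) sJe) _.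
    by rewrite /B cl /= -[X in X%:R + _ + _]addn2 natrD mulr1.
  apply: le_trans (IH h' b _ _ _ _ _ (explored_leaf d2 th_ge0 th_lt1 b ex hs h's cl) sJe) _.
  by rewrite /B (negPf cl) mulr0 addr0.
rewrite lerD2l; apply: ler_wpM2l; first exact: mulr_ge0.
set N' : R := _.-1%:R.
have slack_le : slack <= N' by rewrite ler_nat -subn1 -subnDA leq_sub2l // addn1 ltn_pmul2l.
have N'0 : 0 < N' by apply: lt_le_trans slack_le.
pose x := j%:R * near; have x0 : 0 <= x by rewrite mulr_ge0.
have -> : \sum_(h' | (h' \notin touched s) && (h' != h)) B h' / N'
   = x * ((size W)%:R + j%:R * coll + 1)
     + x * (2 * (\sum_(h' | (h' \notin touched s) && (h' != h)) (h'.1 \in h.1 :: seen s)%:R / N')).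
  transitivity (\sum_(h' | (h' \notin touched s) && (h' != h))
     (x * ((size W)%:R + j%:R * coll + 1) / N' + x * (2 * ((h'.1 \in h.1 :: seen s)%:R / N')))).
    by apply: eq_bigr => h' _; rewrite /B /x; ring.
  rewrite big_split /=; congr (_ + _); last by rewrite -!mulr_sumr.
  rewrite sumr_const.
  have -> : #|[pred h' | (h' \notin touched s) & (h' != h)]| = (n * d - 2 * size s).-1.
    rewrite -(card_untouched (ex_uniq ex)) [in RHS](cardD1 h) inE hs /=.
    by apply: eq_card => z; rewrite !inE andbC.
  by rewrite -[LHS]mulr_natr -/N' divfK ?gt_eqF.
have cE : 2 * (\sum_(h' | (h' \notin touched s) && (h' != h))
    (h'.1 \in h.1 :: seen s)%:R / N') <= coll.
  rewrite -mulr_suml mulrA ler_pdivrMr //.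
  apply: le_trans (_ : (4 * d * J)%:R <= _); last first.
    by rewrite /coll -mulrA ler_peMr ?ler0n // mulrC ler_pdivlMr // mul1r.
  rewrite -[4%N]/(2 * 2)%N -!mulnA natrM; apply: ler_wpM2l => //.
  apply: le_trans (_ : \sum_(h' | h' \notin touched s) (h'.1 \in h.1 :: seen s)%:R <= _).
    rewrite [leRHS](bigID (fun h' => h' != h)) /= -[leLHS]addr0 lerD //.
    by apply: sumr_ge0 => *; rewrite ler0n.
  apply: le_trans (sum_untouched_mem _ _ _) _.
  by rewrite ler_nat /= size_map size_touched [leqRHS]mulnCA leq_mul2l ltn_pmul2l // sJ' orbT.
have cn : 0 <= coll * near by exact: mulr_ge0.
have jcn : 0 <= j%:R * (coll * near) by rewrite mulr_ge0 ?ler0n.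
(* The right side exceeds the left one by at least (j + 1) coll near. *)
have := ler_wpM2l x0 cE; move: (2 * _) => y.
rewrite -[j.+1]addn1 natrD -[(size W).+1]addn1 natrD /x.
clear -cn jcn; move: near coll (j%:R : R) ((size W)%:R : R) cn jcn => *; lra.
Qed.

End Bound.
End Distinguish.

(** * Algorithms as decision trees *)

Section AlgorithmTree.
Variables (n d : nat) (R : realFieldType).
Implicit Types (p : pairing n d) (y : labels n d) (A : algorithm n d).

Lemma decision_tree_ext j (F F' : pairing n d -> labels n d -> R) :
  decision_tree j F -> (forall p y, F p y = F' p y) -> decision_tree j F'.
Proof.
case=> {j F} [j c F c1 FE|j h Q F QF FE] FF'.
  by apply: (DTconst _ c1) => p y; rewrite -FF'.
by apply: (DTquery (h := h) QF) => p y; rewrite -FF'.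
Qed.

(** A vertex query is simulated by querying its d slots one by one. *)
Lemma decision_tree_answer m q (G : answer_t n d -> pairing n d -> labels n d -> R) :
    (forall a, decision_tree m (G a)) ->
  decision_tree (d + m) (fun p y => G (answer p y q) p y).
Proof.
move=> Gdt.
(* Slots below [i] are still to be queried, the others are stored in [a0]. *)
have partial i (a0 : answer_t n d) : (i <= d)%N ->
    decision_tree (i + m) (fun p y => G [ffun j : 'I_d => if (j < i)%N then answer p y q j else a0 j] p y).
  elim: i a0 => [|i IH] a0 id.
    apply: decision_tree_ext (Gdt a0) _ => p y.
    by congr G; apply/ffunP => j; rewrite ffunE.
  pose io := Ordinal id.
  pose a1 (x : half n d) (b : bool) : answer_t n d := [ffun j => if j == io then (x.1, b) else a0 j].
  apply: (DTquery (h := (q, io)) (fun x b => IH (a1 x b) (ltnW id))) => p y /=.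
  congr G; apply/ffunP => j; rewrite !ffunE ltnS leq_eqVlt -(inj_eq val_inj) /=.
  by have [ji|//] := eqVneq (val j) i; rewrite ji ltnn /= (_ : j = io) //; apply: val_inj.
apply: decision_tree_ext (partial d [ffun => (q, false)] (leqnn d)) _ => p y.
by congr G; apply/ffunP => j; rewrite ffunE ltn_ord.
Qed.

(** Unlike [run], this peels off the first query, which is the root of the tree. *)
Fixpoint run_from A p y (j : nat) (hs : history n d) : history n d :=
  if j is j'.+1 then
    let q := alg_query A hs in run_from A p y j' (rcons hs (q, answer p y q))
  else hs.

Lemma run_fromE A p y i j : run A p y (i + j) = run_from A p y j (run A p y i).
Proof. by elim: j i => [|j IH] i; rewrite ?addn0 // addnS -addSn IH. Qed.

Lemma decision_tree_output A k :
  decision_tree (k * d) (fun p y => (output A k p y)%:R : R).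
Proof.
have from hs : decision_tree (k * d) (fun p y => (alg_out A (run_from A p y k hs))%:R : R).
  elim: k hs => [|k IH] hs.
    apply: (@DTconst _ _ _ _ (alg_out A hs)%:R) => //.
    by case: (alg_out A hs); rewrite ?normr0 ?normr1.
  rewrite mulSn.
  exact: (decision_tree_answer (alg_query A hs)
    (G := fun a p y => (alg_out A (run_from A p y k (rcons hs (alg_query A hs, a))))%:R)).
by apply: decision_tree_ext (from [::]) _ => p y; rewrite /output -[k in RHS]add0n run_fromE.
Qed.

Lemma gain_nil (eps : R) : gain eps ([::] : seq (entry n d)) = 1.
Proof.
rewrite /gain (eq_bigr (fun _ => 1)) => [|X _]; last by rewrite /weight big_nil.
rewrite sumr_const card_ffun card_bool card_ord -[_ *+ _]mulr_natl mulr1 natrX.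
by rewrite mulVf // expf_neq0 // pnatr_eq0.
Qed.

(** Only an inequality: for n d odd there is no matching and the sum is 0. *)
Lemma sum_pairing_weight : \sum_(p : pairing n d) pairing_weight R p <= 1.
Proof.
rewrite /pairing_weight -big_mkcond sumr_const -[leLHS]mulr_natl; set c := #|_|.
have [->|c0] := eqVneq c%:R (0 : R); first by rewrite mul0r.
by rewrite divff.
Qed.

Lemma yes_mass_nil : yes_mass R ([::] : seq (entry n d)) <= 1.
Proof.
rewrite /yes_mass expr0 mulr1.
have -> : num_ext ([::] : seq (entry n d)) = #|[pred q : pairing n d | is_matching q]|.
  by apply: eq_card => p; rewrite !inE andbT.
set c := #|_|; have [->|c0] := eqVneq c%:R (0 : R); first by rewrite mul0r.
by rewrite divff.
Qed.

(** The success probability is half the NO mass, at most 1/2, minus half of [total [::]] of the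
    output; [decision_tree_bound] starts from gain 1 and empty [W]. *)
Lemma success_bound (eps : R) A k r (J := (k * d)%N) :
    (2 <= d)%N -> 0 < eps -> 2 * eps <= 1 -> (2 * J < n * d)%N ->
  \sum_(p : pairing n d) pairing_weight R p *
     \sum_(y : labels n d)
       (2^-1 * yes_weight R p y * (if output A k p y then 1 else 0)
        + 2^-1 * no_weight eps p y * (if output A k p y then 0 else 1))
  <= 2^-1 + 2^-1 * (J%:R * (J%:R * ((4 * d * J)%:R / (n * d - 2 * J)%:R) + 1) *
     ((d%:R ^+ r * (2 * d)%:R + (1 - 2 * eps) ^+ r * (2 * d * J)%:R) / (n * d - 2 * J)%:R)).
Proof.
move=> d2 eps0 eps1 Jn.
have th0 : 0 <= 1 - 2 * eps by rewrite subr_ge0.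
have th1 : 1 - 2 * eps < 1 by rewrite gtrBl mulr_gt0.
have ex := explored_nil n (1 - 2 * eps) d2.
have := decision_tree_bound d2 eps0 eps1 r Jn (decision_tree_output A k) ex (leqnn _).
rewrite gain_nil subrr normr0 mulr0 add0r mulr1 /= mulr0n add0r.
rewrite -/J; set B := (X in _ * X); set T := total _ _ _ => TB.
have B0 : 0 <= B.
  by rewrite /B !mulr_ge0 ?addr_ge0 ?mulr_ge0 ?exprn_ge0 ?invr_ge0 ?ler0n.
have {TB}TB : `|T| <= B.
  by apply: le_trans TB _; rewrite ler_piMl // yes_mass_nil.
have -> : \sum_(p : pairing n d) pairing_weight R p *
     \sum_(y : labels n d)
       (2^-1 * yes_weight R p y * (if output A k p y then 1 else 0)
        + 2^-1 * no_weight eps p y * (if output A k p y then 0 else 1))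
   = 2^-1 * (\sum_(p : pairing n d) pairing_weight R p * \sum_(y : labels n d) no_weight eps p y)
     - 2^-1 * T.
  rewrite -mulrBr /T /total -sumrB mulr_sumr; apply: eq_bigr => p _.
  rewrite !mulr_sumr -sumrB mulr_sumr; apply: eq_bigr => y _.
  by case: (output A k p y) => /=; ring.
have noM : \sum_(p : pairing n d) pairing_weight R p * \sum_(y : labels n d) no_weight eps p y <= 1.
  apply: le_trans sum_pairing_weight; apply: ler_sum => p _.
  rewrite {1 2}/pairing_weight; case: ifP => pM; last by rewrite mul0r.
  by rewrite (no_weight_mass eps pM (s := [::])) // gain_nil expr0 mulr1 mulr1.
have : - T <= B by apply: le_trans TB; rewrite -normrN ler_norm.
rewrite -/B => NT; rewrite -mulrBr -[X in _ <= X + _]mulr1 -mulrDr.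
by apply: ler_wpM2l; rewrite ?invr_ge0 // lerD.
Qed.

End AlgorithmTree.

(** * Transfer to the real numbers of the statement *)

Lemma success_probE n d eps (A : algorithm n d) k :
  success_prob eps A k
  = \sum_(p : pairing n d) pairing_weight R p *
       \sum_(y : labels n d)
         (2^-1 * yes_weight R p y * (if output A k p y then 1 else 0)
          + 2^-1 * no_weight eps p y * (if output A k p y then 0 else 1)).
Proof.
apply: eq_bigr => p _; congr Rmult.
  by rewrite /config_prob /pairing_weight INRE.
apply: eq_bigr => y _; congr Rplus; congr Rmult; congr Rmult.
  by rewrite /yes_prob /yes_weight INRE.
rewrite /no_prob /no_weight; case: ifP => // _.
by apply: eq_bigr => X _; rewrite RpowE.
Qed.

Delimit Scope R_scope with R.
Local Open Scope R_scope.

Lemma success_prob_le n d eps (A : algorithm n d) k r :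
    (2 <= d)%N -> 0 < eps <= / 2 -> (2 * (k * d) < n * d)%N ->
  success_prob eps A k
  <= / 2 + / 2 * advantage (INR d) (INR n) (INR k) (INR d ^ r) ((1 - 2 * eps) ^ r).
Proof.
move=> d2 [e0 e1] kn.
rewrite success_probE.
have := @success_bound n d R eps A k r d2.
rewrite natrB; last exact: ltnW.
rewrite !natrM -!INRE -!RpowE => bound.
move: bound; rewrite (_ : INR 2 = 2) // (_ : INR 4 = 4); last by simpl; Lra.lra.
by move=> bound; apply/RleP/bound => //; [exact/RltP | apply/RleP; change (2 * eps <= 1); Lra.lra].
Qed.

Theorem theorem1p4 (d : nat) (eps delta : R) :
  (3 <= d)%N ->
  (0 < eps <= / 2)%R ->
  (delta < Rmin (/ 16) ((/ (8 * ln (INR d))) * eps))%R ->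
  forall eta : R, (0 < eta)%R ->
  exists N : nat, forall n : nat, (N <= n)%N ->
    forall (A : algorithm n d) (k : nat),
      (INR k <= Rpower (INR n) (/ 2 + delta))%R ->
      (success_prob eps A k <= / 2 + eta)%R.
Proof.
move=> d3 eps01 delta_lt eta eta0.
have a3 : 3 <= INR d by rewrite (_ : 3 = INR 3); [apply/le_INR/ssrnat.leP | simpl; Lra.lra].
have la : 0 < ln (INR d) by rewrite -ln_1; apply: ln_increasing; Lra.lra.
have b0 : 0 < / (8 * ln (INR d)) by apply: Rinv_0_lt_compat; Lra.lra.
have d1 := Rmin_l (/ 16) (/ (8 * ln (INR d)) * eps).
have d2 := Rmin_r (/ 16) (/ (8 * ln (INR d)) * eps).
have be : 0 < / (8 * ln (INR d)) * eps by apply: Rmult_lt_0_compat; Lra.lra.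
(* A negative [delta] is replaced by 0, which only enlarges the query budget. *)
pose delta' := Rmax delta 0.
have d'0 : 0 <= delta' by apply: Rmax_r.
have dd' : delta <= delta' by apply: Rmax_l.
have d'16 : delta' < / 16 by apply: Rmax_lub_lt; Lra.lra.
have d'b : delta' < / (8 * ln (INR d)) * eps by apply: Rmax_lub_lt; Lra.lra.
have [M [M1 MP]] := advantage_vanishes a3 eps01 (conj d'0 d'16) d'b eta0.
have [N NM] := INR_unbounded M.
exists N => n Nn A k kle.
have nM : M <= INR n by have := le_INR _ _ (ssrnat.leP Nn); Lra.lra.
have [r [xn rP]] := MP _ nM.
have kle' : INR k <= Rpower (INR n) (/ 2 + delta').
  apply: Rle_trans kle _; apply: Rle_Rpower; Lra.lra.
(* From 4 k <= n and 1 <= n. *)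
have kn : (2 * (k * d) < n * d)%N.
  rewrite mulnA ltn_pmul2r; last exact: leq_trans d3.
  apply/ssrnat.ltP/INR_lt; rewrite -multE mult_INR (_ : INR 2 = 2); last by simpl; Lra.lra.
  Lra.lra.
have := success_prob_le A r (leq_trans _ d3) eps01 kn; move=> /(_ isT) le.
have := rP (INR k) (conj (pos_INR k) kle').
Lra.lra.
Qed.
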